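(* Let $X\subseteq\mathbb{R}^2$ be a finite union of sets of the form $$\{\Phi_{g_1,\theta_1}=0\}\cap\cdots\cap\{\Phi_{g_m,\theta_m}=0\}\cap\{\Phi_{f_1,\beta_1}>0\}\cap\cdots\cap\{\Phi_{f_k,\beta_k}>0\},$$ where $g_i,f_j$ are real polynomials in one variable and $\theta_i,\beta_j$ are angles. Then there exists a cell decomposition of $X$ such that every shortest-length curve between two points of $X$ interacts with each cell at most finitely many times.
   Context: For a real polynomial $p$ and angle $\theta$, $\Phi_{p,\theta}(x,y)=p(x\cos\theta+y\sin\theta)-(-x\sin\theta+y\cos\theta)$; $\{\Phi_{p,\theta}=0\}$ is the graph of $p$ in the coordinate frame rotated by $\theta$, and $\{\Phi_{p,\theta}>0\}$ is the open region below that graph (an open polynomial half plane). A shortest-length curve between $A$ and $B$ in $X$ is a continuous piecewise $C^2$ curve in $X$ from $A$ to $B$ of minimal length $\int|\gamma'|$ among all piecewise $C^2$ curves in $X$ from $A$ to $B$. A cell decomposition of $X$ is a partition of $X$ into at most countably many pairwise disjoint cells, each homeomorphic to $\mathbb{R}^d$, $d\in\{0,1,2\}$. A curve $\gamma$ interacts with a set $e$ at most $N$ times if $\gamma^{-1}(e)$ has at most $N$ connected components. *)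

(* Defs.v *)
From Stdlib Require Import Reals List.
From Coquelicot Require Import Coquelicot.
Open Scope R_scope.

Definition pt := (R * R)%type.

(** Real polynomials in one variable, as coefficient lists (constant term first). *)
Definition rpoly := list R.
Definition peval (p : rpoly) (x : R) : R :=
  fold_right (fun c acc => c + x * acc) 0 p.

Definition Phi (p : rpoly) (th : R) (z : pt) : R :=
  peval p (fst z * cos th + snd z * sin th) - (- fst z * sin th + snd z * cos th).

(** A basic set: a list of equations Phi_{g,theta} = 0 and a list of strict
    inequalities Phi_{f,beta} > 0. *)
Definition basic_set := (list (rpoly * R) * list (rpoly * R))%type.

Definition in_basic (b : basic_set) (z : pt) : Prop :=
  (forall gt, In gt (fst b) -> Phi (fst gt) (snd gt) z = 0) /\
  (forall fb, In fb (snd b) -> Phi (fst fb) (snd fb) z > 0).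

Definition in_union (Bs : list basic_set) (z : pt) : Prop :=
  exists b, In b Bs /\ in_basic b z.

Definition dist2 (z w : pt) : R :=
  sqrt ((fst z - fst w)^2 + (snd z - snd w)^2).

(** e (a subset of R^2 with the subspace topology) is homeomorphic to the
    metric space (D, dD) via f : D -> R^2: f is a bijection onto e, continuous,
    with continuous inverse e -> D (expressed through f). *)
Definition homeo_via {D : Type} (dD : D -> D -> R) (f : D -> pt) (e : pt -> Prop) : Prop :=
  (forall z, e z <-> exists s, z = f s) /\
  (forall s s', f s = f s' -> s = s') /\
  (forall s eps, 0 < eps -> exists delta, 0 < delta /\
      forall s', dD s' s < delta -> dist2 (f s') (f s) < eps) /\
  (forall s eps, 0 < eps -> exists delta, 0 < delta /\
      forall s', dist2 (f s') (f s) < delta -> dD s' s < eps).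

Definition homeo_Rd (e : pt -> Prop) (d : nat) : Prop :=
  match d with
  | 0%nat => exists p : pt, forall z, e z <-> z = p
  | 1%nat => exists f : R -> pt, homeo_via (fun s s' => Rabs (s - s')) f e
  | 2%nat => exists f : pt -> pt, homeo_via dist2 f e
  | _ => False
  end.

(** A cell decomposition of X: an at most countable family of pairwise disjoint
    cells (indexed by the n : nat with used n), each homeomorphic to some R^d,
    d in {0,1,2}, whose union is X. *)
Definition cell_decomposition (X : pt -> Prop)
  (C : nat -> pt -> Prop) (used : nat -> Prop) : Prop :=
  (forall n, used n -> exists d, (d <= 2)%nat /\ homeo_Rd (C n) d) /\
  (forall n m z, used n -> used m -> C n z -> C m z -> n = m) /\
  (forall z, X z <-> exists n, used n /\ C n z).

Definition C2 (h : R -> R) : Prop :=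
  (forall t, ex_derive h t) /\
  (forall t, ex_derive (Derive h) t) /\
  (forall t, continuous (Derive (Derive h)) t).

(** Curves are parametrized on [0,1]: gamma : R -> R^2, only its values on
    [0,1] matter.  Piecewise C^2: there is a subdivision
    0 = t_0 < ... < t_n = 1 such that on each [t_i, t_{i+1}] gamma coincides
    with a C^2 map (hence gamma is continuous on [0,1]). *)
Definition piecewise_C2 (gamma : R -> pt) : Prop :=
  exists (n : nat) (t : nat -> R),
    t 0%nat = 0 /\ t n = 1 /\
    (forall i, (i < n)%nat -> t i < t (S i)) /\
    (forall i, (i < n)%nat -> exists h1 h2 : R -> R, C2 h1 /\ C2 h2 /\
        forall s, t i <= s <= t (S i) -> gamma s = (h1 s, h2 s)).

Definition curve_length (gamma : R -> pt) : R :=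
  RInt (fun s => sqrt ((Derive (fun u => fst (gamma u)) s)^2 +
                       (Derive (fun u => snd (gamma u)) s)^2)) 0 1.

Definition curve_in (X : pt -> Prop) (A B : pt) (gamma : R -> pt) : Prop :=
  piecewise_C2 gamma /\ gamma 0 = A /\ gamma 1 = B /\
  (forall s, 0 <= s <= 1 -> X (gamma s)).

Definition shortest_curve (X : pt -> Prop) (A B : pt) (gamma : R -> pt) : Prop :=
  curve_in X A B gamma /\
  forall delta, curve_in X A B delta -> curve_length gamma <= curve_length delta.

(** Convex subsets of R (= intervals, = connected subsets). *)
Definition convex_R (I : R -> Prop) : Prop :=
  forall x y z, I x -> I y -> x <= z <= y -> I z.

(** S subset of R has at most N connected components iff S is the union of
    at most N convex subsets of S. *)
Definition at_most_N_components (S : R -> Prop) (N : nat) : Prop :=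
  exists I : nat -> R -> Prop,
    (forall k, (k < N)%nat -> convex_R (I k)) /\
    (forall s, S s <-> exists k, (k < N)%nat /\ I k s).

Definition interacts_at_most (gamma : R -> pt) (e : pt -> Prop) (N : nat) : Prop :=
  at_most_N_components (fun s => 0 <= s <= 1 /\ e (gamma s)) N.

(* Main.v *)
Require Import Defs.
From Stdlib Require Import Reals List Lra Lia Classical Cantor.
From Coquelicot Require Import Coquelicot.
Open Scope R_scope.

(** A shortest curve [g] is straight between two times [s], [t] whenever the segment from [g s] to
    [g t] lies in [X]; hence it meets every convex cell in at most one piece.  Since countably many
    cells are allowed, the interior of [X] is cut into dyadic open squares, edges and vertices,
    which are convex.  The rest of [X] lies on finitely many polynomial graphs.  Off finitely many
    points of such a graph, [X] is locally the graph together with at most one of its two sides,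
    and the graph is locally straight or strictly curved.  On a small arc, either the arc is
    straight, or its chords lie in [X] (and then [g] meets the arc in at most two points), or [X]
    contains nothing on the chord side; in the last case [g] cannot leave the arc towards the other
    side and come back while staying close, because the signed height over the graph would have an
    interior minimum along straight pieces on which it is strictly concave.  Uniform continuity of
    [g] bounds the number of excursions that do not stay close. *)

(** * Length and minimality *)

Definition speed (g : R -> pt) (s : R) : R :=
  sqrt ((Derive (fun u => fst (g u)) s) ^ 2 + (Derive (fun u => snd (g u)) s) ^ 2).

Definition C2_on (g : R -> pt) (a b : R) : Prop :=
  exists h1 h2 : R -> R, C2 h1 /\ C2 h2 /\ forall s, a <= s <= b -> g s = (h1 s, h2 s).

Lemma dist2_sym (z w : pt) : dist2 z w = dist2 w z.
Proof. unfold dist2; f_equal; ring. Qed.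

Lemma dist2_ge_0 (z w : pt) : 0 <= dist2 z w.
Proof. apply sqrt_pos. Qed.

Lemma dist2_sqr (z w : pt) :
  dist2 z w * dist2 z w = (fst z - fst w) ^ 2 + (snd z - snd w) ^ 2.
Proof. unfold dist2; apply sqrt_sqrt, Rplus_le_le_0_compat; apply pow2_ge_0. Qed.

Lemma cauchy_schwarz_plane (a b c d : R) :
  a * c + b * d <= sqrt (a ^ 2 + b ^ 2) * sqrt (c ^ 2 + d ^ 2).
Proof.
  rewrite <- sqrt_mult by nra.
  apply Rle_trans with (Rabs (a * c + b * d)); [apply Rle_abs|].
  rewrite <- sqrt_Rsqr_abs. apply sqrt_le_1_alt; unfold Rsqr.
  assert (0 <= (a * d - b * c) ^ 2) by apply pow2_ge_0. nra.
Qed.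

Lemma dist2_triangle (x y z : pt) : dist2 x z <= dist2 x y + dist2 y z.
Proof.
  apply Rsqr_incr_0_var; [|pose proof (dist2_ge_0 x y); pose proof (dist2_ge_0 y z); lra].
  unfold Rsqr.
  pose proof (dist2_sqr x y); pose proof (dist2_sqr y z); pose proof (dist2_sqr x z).
  pose proof (cauchy_schwarz_plane (fst x - fst y) (snd x - snd y)
                (fst y - fst z) (snd y - snd z)) as H2.
  change (sqrt _ * sqrt _) with (dist2 x y * dist2 y z) in H2. nra.
Qed.

Lemma speed_ext (g h : R -> pt) (a b : R) :
  (forall s, a <= s <= b -> g s = h s) ->
  forall s, a < s < b -> speed g s = speed h s.
Proof.
  intros Hg s Hs. unfold speed.
  assert (L : locally s (fun t => a < t < b)).
  { apply (locally_interval _ s a b); simpl; try tauto. }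
  rewrite (Derive_ext_loc (fun u => fst (g u)) (fun u => fst (h u))),
          (Derive_ext_loc (fun u => snd (g u)) (fun u => snd (h u))); try reflexivity;
  revert L; apply filter_imp; intros t Ht; rewrite Hg; simpl; lra.
Qed.

Lemma C2_on_speed_ext (g : R -> pt) (h1 h2 : R -> R) (a b : R) :
  (forall s, a <= s <= b -> g s = (h1 s, h2 s)) ->
  forall s, a < s < b -> sqrt ((Derive h1 s) ^ 2 + (Derive h2 s) ^ 2) = speed g s.
Proof.
  intros Hg s Hs. symmetry. exact (speed_ext g (fun s => (h1 s, h2 s)) a b Hg s Hs).
Qed.

Lemma C2_on_speed (g : R -> pt) (a b : R) :
  a < b -> C2_on g a b ->
  ex_RInt (speed g) a b /\ dist2 (g a) (g b) <= RInt (speed g) a b.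
Proof.
  intros Hab (h1 & h2 & (D1 & DD1 & _) & (D2 & DD2 & _) & Hg).
  set (sp := fun s => sqrt ((Derive h1 s) ^ 2 + (Derive h2 s) ^ 2)).
  assert (Hext : forall s, Rmin a b < s < Rmax a b -> sp s = speed g s).
  { rewrite Rmin_left, Rmax_right by lra. exact (C2_on_speed_ext g h1 h2 a b Hg). }
  assert (c1 : forall s, continuous (Derive h1) s) by (intros; apply (ex_derive_continuous (Derive h1)), DD1).
  assert (c2 : forall s, continuous (Derive h2) s) by (intros; apply (ex_derive_continuous (Derive h2)), DD2).
  assert (Hsp : forall s, continuous sp s).
  { intros s. apply (continuous_comp _ sqrt); [|apply continuous_sqrt].
    apply (continuous_plus (fun s => Derive h1 s ^ 2) (fun s => Derive h2 s ^ 2)).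
    - apply (continuous_ext (fun s => Derive h1 s * Derive h1 s)); [intros x; change (Derive h1 x * Derive h1 x = Derive h1 x ^ 2); ring|].
      apply (continuous_mult (Derive h1) (Derive h1)); apply c1.
    - apply (continuous_ext (fun s => Derive h2 s * Derive h2 s)); [intros x; change (Derive h2 x * Derive h2 x = Derive h2 x ^ 2); ring|].
      apply (continuous_mult (Derive h2) (Derive h2)); apply c2. }
  assert (Isp : ex_RInt sp a b) by (apply (ex_RInt_continuous sp); auto).
  split; [exact (ex_RInt_ext _ _ _ _ Hext Isp)|].
  rewrite <- (RInt_ext _ _ _ _ Hext), !Hg by lra.
  set (D := dist2 (h1 a, h2 a) (h1 b, h2 b)).
  assert (HD0 : 0 <= D) by apply dist2_ge_0.
  assert (HL0 : 0 <= RInt sp a b) by (apply RInt_ge_0; [lra|exact Isp|intros; apply sqrt_pos]).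
  set (k1 := h1 b - h1 a). set (k2 := h2 b - h2 a).
  assert (HDk : D = sqrt (k1 ^ 2 + k2 ^ 2)) by (unfold D, dist2, k1, k2; simpl; f_equal; ring).
  assert (HDD : D * D = k1 ^ 2 + k2 ^ 2) by (rewrite HDk; apply sqrt_sqrt; nra).
  assert (Hk : is_RInt (fun s => k1 * Derive h1 s + k2 * Derive h2 s) a b (k1 * k1 + k2 * k2)).
  { apply (is_RInt_plus (fun s => k1 * Derive h1 s) (fun s => k2 * Derive h2 s)).
    - apply (is_RInt_scal (Derive h1)), (is_RInt_derive h1); intros; [apply Derive_correct, D1|apply c1].
    - apply (is_RInt_scal (Derive h2)), (is_RInt_derive h2); intros; [apply Derive_correct, D2|apply c2]. }
  assert (Hle : D * D <= D * RInt sp a b).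
  { rewrite HDD. replace (k1 ^ 2 + k2 ^ 2) with (k1 * k1 + k2 * k2) by ring.
    apply (is_RInt_le (fun s => k1 * Derive h1 s + k2 * Derive h2 s) (fun s => D * sp s) a b); [lra|exact Hk| |].
    - apply (is_RInt_scal sp), (RInt_correct sp), Isp.
    - intros s _. rewrite HDk. apply cauchy_schwarz_plane. }
  destruct (Req_dec D 0); [lra|nra].
Qed.

Inductive chain_C2 (g : R -> pt) : R -> R -> Prop :=
| chain_nil a : chain_C2 g a a
| chain_cons a b c : a < b -> C2_on g a b -> chain_C2 g b c -> chain_C2 g a c.

Lemma piecewise_C2_chain (g : R -> pt) : piecewise_C2 g <-> chain_C2 g 0 1.
Proof.
  split.
  - intros (n & t & H0 & Hn & Hlt & HC). rewrite <- H0, <- Hn. clear H0 Hn.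
    revert t Hlt HC. induction n as [|n IH]; intros t Hlt HC; [apply chain_nil|].
    apply chain_cons with (t 1%nat); [apply Hlt; lia|apply (HC 0%nat); lia|].
    apply (IH (fun i => t (S i))); intros i Hi; [apply Hlt|apply (HC (S i))]; lia.
  - assert (G : forall a b, chain_C2 g a b -> exists (n : nat) (t : nat -> R),
      t 0%nat = a /\ t n = b /\ (forall i, (i < n)%nat -> t i < t (S i)) /\
      (forall i, (i < n)%nat -> C2_on g (t i) (t (S i)))).
    { intros a b H. induction H as [a|a b c Hab HC _ (n & t & H0 & Hn & Hlt & HC')].
      - exists 0%nat, (fun _ => a). repeat split; intros; lia.
      - exists (S n), (fun i => match i with O => a | S j => t j end).
        repeat split; auto.
        + intros [|i] Hi; [rewrite H0; auto|apply Hlt; lia].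
        + intros [|i] Hi; [rewrite H0; auto|apply HC'; lia]. }
    intros H. destruct (G 0 1 H) as (n & t & H'). exists n, t. exact H'.
Qed.

Lemma chain_le (g : R -> pt) (a b : R) : chain_C2 g a b -> a <= b.
Proof. induction 1; lra. Qed.

Lemma chain_app (g : R -> pt) (a b c : R) :
  chain_C2 g a b -> chain_C2 g b c -> chain_C2 g a c.
Proof. induction 1; intros; auto. eapply chain_cons; eauto. Qed.

Lemma C2_on_sub (g : R -> pt) (a b a' b' : R) :
  a <= a' -> b' <= b -> C2_on g a b -> C2_on g a' b'.
Proof.
  intros ? ? (h1 & h2 & ? & ? & Hg). exists h1, h2; repeat split; try apply H1; try apply H2.
  intros; apply Hg; lra.
Qed.

Lemma chain_split (g : R -> pt) (a b u : R) :
  chain_C2 g a b -> a <= u <= b -> chain_C2 g a u /\ chain_C2 g u b.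
Proof.
  intros H. induction H as [a|a b c Hab HC Hch IH]; intros Hu.
  - replace u with a by lra. split; apply chain_nil.
  - destruct (Rle_lt_dec b u) as [Hbu|Hub].
    + destruct IH as [I1 I2]; [lra|]. split; auto. eapply chain_cons; eauto.
    + destruct (Req_dec a u) as [->|Hau].
      * split; [apply chain_nil|]. eapply chain_cons; eauto.
      * split.
        -- apply chain_cons with u; [lra| |apply chain_nil]. apply (C2_on_sub g a b); auto; lra.
        -- apply chain_cons with b; [lra| |auto]. apply (C2_on_sub g a b); auto; lra.
Qed.

Lemma chain_ext (g h : R -> pt) (a b : R) :
  (forall s, a <= s <= b -> g s = h s) -> chain_C2 g a b -> chain_C2 h a b.
Proof.
  intros E H. revert E. induction H as [a|a b c Hab HC Hch IH]; intros E; [apply chain_nil|].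
  pose proof (chain_le _ _ _ Hch).
  apply chain_cons with b; auto; [|apply IH; intros; apply E; lra].
  destruct HC as (h1 & h2 & ? & ? & Hg). exists h1, h2; repeat split; try apply H0; try apply H1.
  intros; rewrite <- E by lra; apply Hg; lra.
Qed.

Lemma chain_length (g : R -> pt) (a b : R) :
  chain_C2 g a b -> ex_RInt (speed g) a b /\ dist2 (g a) (g b) <= RInt (speed g) a b.
Proof.
  induction 1 as [a|a b c Hab HC Hch [I1 I2]].
  - split; [apply ex_RInt_point|]. rewrite RInt_point.
    unfold dist2. replace (_ + _) with 0 by ring. rewrite sqrt_0. apply Rle_refl.
  - destruct (C2_on_speed g a b Hab HC) as [J1 J2].
    split; [eapply ex_RInt_Chasles; eauto|].
    rewrite <- (RInt_Chasles (speed g) a b c) by auto.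
    pose proof (dist2_triangle (g a) (g b) (g c)). unfold plus; simpl. lra.
Qed.

Lemma chain_C2_continuous (g : R -> pt) (a b : R) :
  chain_C2 g a b ->
  exists k1 k2 : R -> R, (forall s, continuity_pt k1 s) /\ (forall s, continuity_pt k2 s) /\
    forall s, a <= s <= b -> g s = (k1 s, k2 s).
Proof.
  induction 1 as [a|a b c Hab HC Hch (k1 & k2 & c1 & c2 & Hk)].
  - exists (fun _ => fst (g a)), (fun _ => snd (g a)).
    split; [|split]; try (intros; apply continuity_pt_const; intros ? ?; reflexivity).
    intros s Hs. replace s with a by lra. apply surjective_pairing.
  - pose proof (chain_le _ _ _ Hch).
    destruct HC as (h1 & h2 & (D1 & _) & (D2 & _) & Hg).
    assert (Hb : h1 b = k1 b /\ h2 b = k2 b).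
    { assert (E : (h1 b, h2 b) = (k1 b, k2 b)) by (rewrite <- Hg, <- Hk; auto; lra).
      inversion E; auto. }
    exists (fun s => h1 (Rmin s b) + k1 (Rmax s b) - k1 b),
           (fun s => h2 (Rmin s b) + k2 (Rmax s b) - k2 b).
    assert (cmin : forall s, continuity_pt (fun s => Rmin s b) s).
    { intros s eps He. exists eps; split; auto. intros x [_ Hx]. simpl in *. unfold R_dist in *.
      unfold Rmin; destruct (Rle_dec x b), (Rle_dec s b); revert Hx; unfold Rabs;
      repeat destruct Rcase_abs; lra. }
    assert (cmax : forall s, continuity_pt (fun s => Rmax s b) s).
    { intros s eps He. exists eps; split; auto. intros x [_ Hx]. simpl in *. unfold R_dist in *.
      unfold Rmax; destruct (Rle_dec x b), (Rle_dec s b); revert Hx; unfold Rabs;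
      repeat destruct Rcase_abs; lra. }
    assert (G : forall h k : R -> R, (forall s, ex_derive h s) -> (forall s, continuity_pt k s) ->
      forall s, continuity_pt (fun s => h (Rmin s b) + k (Rmax s b) - k b) s).
    { intros h k Dh ck s. apply continuity_pt_minus; [apply continuity_pt_plus|].
      - apply (continuity_pt_comp (fun s => Rmin s b) h); auto.
        apply continuity_pt_filterlim, (ex_derive_continuous h), Dh.
      - apply (continuity_pt_comp (fun s => Rmax s b) k); auto.
      - apply continuity_pt_const; intros ? ?; reflexivity. }
    split; [|split]; auto.
    intros s Hs. destruct (Rle_lt_dec s b).
    + rewrite Rmin_left, Rmax_right, Hg by lra. f_equal; lra.
    + rewrite Rmin_right, Rmax_left, Hk by lra. destruct Hb as [-> ->]. f_equal; lra.
Qed.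

Definition seg (a b : pt) (l : R) : pt :=
  ((1 - l) * fst a + l * fst b, (1 - l) * snd a + l * snd b).

Lemma C2_affine (c d : R) : C2 (fun s => c + d * s).
Proof.
  assert (D1 : forall t, is_derive (fun s => c + d * s) t d) by (intros; auto_derive; auto; ring).
  assert (E1 : forall t, Derive (fun s => c + d * s) t = d) by (intros; apply is_derive_unique, D1).
  assert (D2 : forall t, is_derive (Derive (fun s => c + d * s)) t 0).
  { intros t. apply (is_derive_ext (fun _ => d)); [intros; rewrite E1; auto|]. apply (is_derive_const d t). }
  split; [|split]; intros t; [eexists; apply D1|eexists; apply D2|].
  apply (continuous_ext (fun _ => 0)); [|apply continuous_const].
  intros; symmetry; apply is_derive_unique, D2.
Qed.

Lemma sum_sqr_le_0 (x y : R) : x ^ 2 + y ^ 2 <= 0 -> x = 0 /\ y = 0.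
Proof.
  intros H. pose proof (pow2_ge_0 x). pose proof (pow2_ge_0 y).
  split; apply Rsqr_0_uniq; unfold Rsqr; lra.
Qed.

Lemma dist2_additive_seg (a w b : pt) :
  dist2 a w + dist2 w b <= dist2 a b -> exists l, 0 <= l <= 1 /\ w = seg a b l.
Proof.
  intros H. pose proof (dist2_ge_0 a w) as P. pose proof (dist2_ge_0 w b) as Q.
  pose proof (dist2_sqr a w) as P2. pose proof (dist2_sqr w b) as Q2.
  pose proof (dist2_sqr a b) as D2.
  set (p := dist2 a w) in *. set (q := dist2 w b) in *. set (D := dist2 a b) in *.
  destruct a as [a1 a2], w as [w1 w2], b as [b1 b2]; simpl in *. unfold seg; simpl.
  destruct (Req_dec (p + q) 0) as [Z|Z].
  - exists 0. split; [lra|]. assert (p = 0) by lra.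
    destruct (sum_sqr_le_0 (a1 - w1) (a2 - w2)); [nra|].
    f_equal; lra.
  - assert (DD : (p + q) * (p + q) <= D * D) by (apply Rmult_le_compat; lra).
    set (x1 := w1 - a1). set (x2 := w2 - a2). set (y1 := b1 - w1). set (y2 := b2 - w2).
    assert (E : (q * x1 - p * y1) ^ 2 + (q * x2 - p * y2) ^ 2 <= 0).
    { assert (Px : p * p = x1 ^ 2 + x2 ^ 2) by (unfold x1, x2; nra).
      assert (Qy : q * q = y1 ^ 2 + y2 ^ 2) by (unfold y1, y2; nra).
      assert (Dxy : D * D = (x1 + y1) ^ 2 + (x2 + y2) ^ 2) by (unfold x1, x2, y1, y2; nra).
      assert (pq : p * q <= x1 * y1 + x2 * y2) by nra.
      replace ((q * x1 - p * y1) ^ 2 + (q * x2 - p * y2) ^ 2) with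
        ((q * q) * (x1 ^ 2 + x2 ^ 2) + (p * p) * (y1 ^ 2 + y2 ^ 2)
         - 2 * (p * q) * (x1 * y1 + x2 * y2)) by ring.
      rewrite <- Px, <- Qy.
      assert (0 <= p * q) by (apply Rmult_le_pos; auto). nra. }
    apply sum_sqr_le_0 in E. destruct E as [E1 E2].
    exists (p / (p + q)). split.
    + split; [apply Rmult_le_pos; [lra|left; apply Rinv_0_lt_compat; lra]|].
      apply Rmult_le_reg_r with (p + q); [lra|]. field_simplify; lra.
    + unfold x1, x2, y1, y2 in *.
      f_equal; apply Rmult_eq_reg_r with (p + q); auto; field_simplify; auto; nra.
Qed.

Lemma seg_0 (a b : pt) : seg a b 0 = a.
Proof. destruct a; unfold seg; simpl; f_equal; ring. Qed.

Lemma seg_1 (a b : pt) : seg a b 1 = b.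
Proof. destruct a, b; unfold seg; simpl; f_equal; ring. Qed.

Lemma shortest_in_seg (X : pt -> Prop) (A B : pt) (g : R -> pt) (s t : R) :
  shortest_curve X A B g -> 0 <= s -> t <= 1 ->
  (forall l, 0 <= l <= 1 -> X (seg (g s) (g t) l)) ->
  forall w, s <= w <= t -> exists l, 0 <= l <= 1 /\ g w = seg (g s) (g t) l.
Proof.
  intros [(HP & H0 & H1 & HX) Hmin] Hs Ht Hseg w Hw.
  apply piecewise_C2_chain in HP.
  destruct (Req_dec s t) as [Est|Nst].
  { exists 0. rewrite seg_0. split; [lra|]. f_equal; lra. }
  assert (Hst : s < t) by lra.
  destruct (chain_split g 0 1 s HP) as [C0s Cs1]; [lra|].
  destruct (chain_split g s 1 t Cs1) as [Cst Ct1]; [lra|].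
  destruct (chain_split g s t w Cst Hw) as [Csw Cwt].
  set (k1 := (fst (g t) - fst (g s)) / (t - s)). set (k2 := (snd (g t) - snd (g s)) / (t - s)).
  set (e := fun u : R => ((fst (g s) - k1 * s) + k1 * u, (snd (g s) - k2 * s) + k2 * u)).
  assert (Eseg : forall u, e u = seg (g s) (g t) ((u - s) / (t - s))).
  { intros u. unfold e, seg, k1, k2. f_equal; field; lra. }
  assert (Es : e s = g s).
  { rewrite Eseg. replace ((s - s) / (t - s)) with 0 by (field; lra). apply seg_0. }
  assert (Et : e t = g t).
  { rewrite Eseg. replace ((t - s) / (t - s)) with 1 by (field; lra). apply seg_1. }
  set (d := fun u => if Rlt_dec s u then if Rlt_dec u t then e u else g u else g u).
  assert (d1 : forall u, u <= s -> d u = g u).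
  { intros u Hu; unfold d; destruct (Rlt_dec s u); [lra|auto]. }
  assert (d2 : forall u, t <= u -> d u = g u).
  { intros u Hu; unfold d; destruct (Rlt_dec s u); auto. destruct (Rlt_dec u t); [lra|auto]. }
  assert (d3 : forall u, s <= u <= t -> d u = e u).
  { intros u Hu. unfold d. destruct (Rlt_dec s u); [destruct (Rlt_dec u t)|]; auto.
    - replace u with t by lra; auto.
    - replace u with s by lra; auto. }
  assert (De : C2_on e s t).
  { exists (fun u => (fst (g s) - k1 * s) + k1 * u), (fun u => (snd (g s) - k2 * s) + k2 * u).
    split; [apply C2_affine|split; [apply C2_affine|auto]]. }
  assert (Ce : chain_C2 e s t) by (apply chain_cons with t; auto; apply chain_nil).
  assert (D0s : chain_C2 d 0 s) by (apply (chain_ext g); auto; intros; symmetry; apply d1; lra).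
  assert (Dt1 : chain_C2 d t 1) by (apply (chain_ext g); auto; intros; symmetry; apply d2; lra).
  assert (Dst : chain_C2 d s t) by (apply (chain_ext e); auto; intros; symmetry; apply d3; lra).
  assert (Hd : curve_in X A B d).
  { split; [|split; [|split]].
    - apply piecewise_C2_chain. apply chain_app with s; auto. apply chain_app with t; auto.
    - rewrite d1; auto.
    - rewrite d2; auto.
    - intros u Hu. destruct (Rle_lt_dec u s); [rewrite d1; auto|].
      destruct (Rle_lt_dec t u); [rewrite d2; auto|].
      rewrite d3, Eseg by lra. apply Hseg.
      split; [apply Rmult_le_pos; [lra|left; apply Rinv_0_lt_compat; lra]|].
      apply Rmult_le_reg_r with (t - s); [lra|]. field_simplify; lra. }
  specialize (Hmin d Hd).
  change (RInt (speed g) 0 1 <= RInt (speed d) 0 1) in Hmin.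
  pose proof (chain_length _ _ _ C0s) as [J1 _]. pose proof (chain_length _ _ _ Cst) as [J2 _].
  pose proof (chain_length _ _ _ Ct1) as [J3 _]. pose proof (chain_length _ _ _ Csw) as [J4 J4'].
  pose proof (chain_length _ _ _ Cwt) as [J5 J5'].
  pose proof (chain_length _ _ _ Cs1) as [J6 _].
  pose proof (chain_length _ _ _ D0s) as [K1 _]. pose proof (chain_length _ _ _ Dst) as [K2 _].
  pose proof (chain_length _ _ _ Dt1) as [K3 _].
  rewrite <- (RInt_Chasles (speed g) 0 s 1), <- (RInt_Chasles (speed g) s t 1),
    <- (RInt_Chasles (speed d) 0 s 1), <- (RInt_Chasles (speed d) s t 1),
    <- (RInt_Chasles (speed g) s w t) in Hmin; auto;
    try (apply (ex_RInt_Chasles (speed d) s t 1); assumption).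
  rewrite (RInt_ext (speed d) (speed g) 0 s) in Hmin.
  2:{ rewrite Rmin_left, Rmax_right by lra. apply speed_ext. intros; apply d1; lra. }
  rewrite (RInt_ext (speed d) (speed g) t 1) in Hmin.
  2:{ rewrite Rmin_left, Rmax_right by lra. apply speed_ext. intros; apply d2; lra. }
  rewrite (RInt_ext (speed d) (fun _ => sqrt (k1 ^ 2 + k2 ^ 2)) s t) in Hmin.
  2:{ rewrite Rmin_left, Rmax_right by lra. intros u Hu.
      rewrite <- (C2_on_speed_ext d (fun u => (fst (g s) - k1 * s) + k1 * u)
                   (fun u => (snd (g s) - k2 * s) + k2 * u) s t d3 u Hu).
      f_equal. f_equal; f_equal; apply is_derive_unique; auto_derive; auto; ring. }
  rewrite RInt_const in Hmin.
  assert (El : (t - s) * sqrt (k1 ^ 2 + k2 ^ 2) = dist2 (g s) (g t)).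
  { rewrite <- (sqrt_Rsqr (t - s)) at 1 by lra. rewrite <- sqrt_mult by (unfold Rsqr; nra).
    unfold dist2, k1, k2, Rsqr. f_equal. field; lra. }
  apply dist2_additive_seg.
  unfold plus, scal in Hmin; simpl in Hmin. unfold mult in Hmin; simpl in Hmin.
  replace (k1 * (k1 * 1) + k2 * (k2 * 1)) with (k1 ^ 2 + k2 ^ 2) in Hmin by ring.
  rewrite El in Hmin. lra.
Qed.

(** * Interaction of shortest curves with convex sets and arcs *)

Lemma seg_same (a : pt) (l : R) : seg a a l = a.
Proof. destruct a; unfold seg; simpl; f_equal; ring. Qed.

Lemma shortest_const (X : pt -> Prop) (A B : pt) (g : R -> pt) (s t w : R) :
  shortest_curve X A B g -> 0 <= s -> t <= 1 -> s <= w <= t -> g s = g t -> g w = g s.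
Proof.
  intros Hg Hs Ht Hw E.
  destruct (shortest_in_seg X A B g s t Hg Hs Ht) with (w := w) as (l & _ & El); auto.
  - intros l _. rewrite E, seg_same. rewrite <- E. apply (proj1 Hg); lra.
  - rewrite El, E, seg_same. reflexivity.
Qed.

Lemma interacts_convex (X S : pt -> Prop) (A B : pt) (g : R -> pt) :
  shortest_curve X A B g -> (forall z, S z -> X z) ->
  (forall a b l, S a -> S b -> 0 <= l <= 1 -> S (seg a b l)) ->
  interacts_at_most g S 1.
Proof.
  intros Hg HS HC. exists (fun _ s => 0 <= s <= 1 /\ S (g s)). split.
  - intros _ _ s t w [Hs Ss] [Ht St] Hw. split; [lra|].
    destruct (shortest_in_seg X A B g s t Hg) with (w := w) as (l & Hl & El); try lra.
    + intros l Hl. auto.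
    + rewrite El. auto.
  - intros s; split; [intros H; exists 0%nat; auto|intros (k & _ & H); auto].
Qed.

Lemma interacts_two_values (X S : pt -> Prop) (A B : pt) (g : R -> pt) :
  shortest_curve X A B g ->
  (forall a b l, S a -> S b -> 0 <= l <= 1 -> X (seg a b l)) ->
  (forall a b l, S a -> S b -> 0 <= l <= 1 -> S (seg a b l) -> seg a b l = a \/ seg a b l = b) ->
  exists N, interacts_at_most g S N.
Proof.
  intros Hg HX HS.
  assert (M : forall s w t, 0 <= s -> t <= 1 -> s <= w <= t -> S (g s) -> S (g w) -> S (g t) ->
    g w = g s \/ g w = g t).
  { intros s w t Hs Ht Hw Ss Sw St.
    destruct (shortest_in_seg X A B g s t Hg) with (w := w) as (l & Hl & El); auto; try lra.
    rewrite El in Sw |- *. auto. }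
  assert (Cv : forall a, convex_R (fun s => 0 <= s <= 1 /\ g s = a)).
  { intros a s t w [Hs Es] [Ht Et] Hw. split; [lra|].
    rewrite (shortest_const X A B g s t w); auto; try lra. congruence. }
  destruct (classic (exists s, 0 <= s <= 1 /\ S (g s))) as [(s0 & H0 & S0)|No].
  2:{ exists 0%nat, (fun _ _ => False). split; [intros; lia|].
      intros s; split; [intros; exfalso; eauto|intros (k & Hk & _); lia]. }
  destruct (classic (exists s, 0 <= s <= 1 /\ S (g s) /\ g s <> g s0)) as [(s1 & H1 & S1 & N1)|No].
  2:{ exists 1%nat, (fun _ s => 0 <= s <= 1 /\ g s = g s0). split; [intros; apply Cv|].
      intros s; split.
      - intros [Hs Ss]. exists 0%nat. split; [lia|split; auto].
        apply NNPP; intros N. apply No. eauto.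
      - intros (_ & _ & Hs & Es). rewrite Es. auto. }
  exists 2%nat, (fun k s => 0 <= s <= 1 /\ g s = g (if Nat.eqb k 0 then s0 else s1)).
  split; [intros; apply Cv|]. intros s; split.
  - intros [Hs Ss].
    assert (D : g s = g s0 \/ g s = g s1).
    { destruct (Rle_dec s0 s1), (Rle_dec s s0), (Rle_dec s s1); try lra.
      - destruct (M s s0 s1); auto; try lra; congruence.
      - destruct (M s0 s s1); auto; lra.
      - destruct (M s0 s1 s); auto; try lra; congruence.
      - destruct (M s s1 s0); auto; try lra; congruence.
      - destruct (M s1 s s0); auto; try lra; tauto.
      - destruct (M s1 s0 s); auto; try lra; congruence. }
    destruct D; [exists 0%nat|exists 1%nat]; simpl; auto.
  - intros (k & _ & Hs & Es). rewrite Es. destruct (Nat.eqb k 0); auto.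
Qed.

Lemma first_zero (h : R -> R) (s w : R) :
  (forall u, continuity_pt h u) -> s <= w -> h w = 0 ->
  exists v, s <= v <= w /\ h v = 0 /\ forall u, s <= u < v -> h u <> 0.
Proof.
  intros Hc Hsw Hw.
  set (E := fun v => s <= v /\ forall u, s <= u <= v -> h u <> 0).
  destruct (Req_dec (h s) 0) as [Z|NZ].
  { exists s. repeat split; auto; try lra. intros; lra. }
  assert (ub : forall v, E v -> v <= w).
  { intros v [Hv H]. apply Rnot_lt_le; intros L. apply (H w); auto; lra. }
  destruct (completeness E) as (m & Hub & Hlub).
  { exists w. intros v Hv. auto. }
  { exists s. split; [lra|]. intros u Hu. replace u with s by lra. auto. }
  assert (Hbelow : forall u, s <= u < m -> h u <> 0).
  { intros u Hu Z. assert (m <= u); [|lra]. apply Hlub. intros v [Hv H].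
    apply Rnot_lt_le; intros L. apply (H u); auto; lra. }
  assert (Hsm : s <= m).
  { apply Hub. split; [lra|]. intros u Hu. replace u with s by lra. auto. }
  exists m. split; [split; [auto|apply Hlub; intros v; apply ub]|]. split; auto.
  apply NNPP; intros NZm.
  destruct (Hc m (Rabs (h m))) as (d & Hd & Hcm); [apply Rabs_pos_lt; auto|].
  assert (m + d / 2 <= m); [|lra]. apply Hub. split; [lra|].
  intros u Hu Z. destruct (Rlt_dec u m); [apply (Hbelow u); auto; lra|].
  destruct (Req_dec u m) as [->|Nu]; [auto|].
  specialize (Hcm u). simpl in Hcm. unfold R_dist in Hcm. rewrite Z in Hcm.
  replace (0 - h m) with (- h m) in Hcm by ring. rewrite Rabs_Ropp in Hcm.
  apply (Rlt_irrefl (Rabs (h m))), Hcm. split; [split; [exact I|auto]|].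
  rewrite Rabs_right; lra.
Qed.

Lemma last_zero (h : R -> R) (w t : R) :
  (forall u, continuity_pt h u) -> w <= t -> h w = 0 ->
  exists v, w <= v <= t /\ h v = 0 /\ forall u, v < u <= t -> h u <> 0.
Proof.
  intros Hc Hwt Hw.
  destruct (first_zero (fun u => h (- u)) (- t) (- w)) as (v & Hv & Zv & Fv); try lra.
  - intros u. apply (continuity_pt_comp Ropp h); auto.
    apply continuity_pt_opp, derivable_continuous_pt, derivable_pt_id.
  - rewrite Ropp_involutive; auto.
  - exists (- v). repeat split; auto; try lra.
    intros u Hu. rewrite <- (Ropp_involutive u). apply Fv. lra.
Qed.

Lemma continuity_pt_near (k : R -> R) (v eps : R) :
  continuity_pt k v -> 0 < eps ->
  exists d, 0 < d /\ forall u, Rabs (u - v) < d -> Rabs (k u - k v) < eps.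
Proof.
  intros H He. destruct (H eps He) as (d & Hd & Hc). exists d. split; auto.
  intros u Hu. destruct (Req_dec v u) as [<-|N].
  - rewrite Rminus_diag, Rabs_R0; auto.
  - apply Hc. split; [split; [exact I|auto]|exact Hu].
Qed.

Lemma convex_comb_near (a b z eps l : R) :
  Rabs (a - z) < eps -> Rabs (b - z) < eps -> 0 <= l <= 1 ->
  Rabs ((1 - l) * a + l * b - z) < eps.
Proof.
  intros H1 H2 Hl. apply Rabs_def2 in H1, H2.
  destruct (Rle_dec a b).
  - assert (0 <= (1 - l) * (b - a)) by (apply Rmult_le_pos; lra).
    assert (0 <= l * (b - a)) by (apply Rmult_le_pos; lra). apply Rabs_def1; lra.
  - assert (0 <= (1 - l) * (a - b)) by (apply Rmult_le_pos; lra).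
    assert (0 <= l * (a - b)) by (apply Rmult_le_pos; lra). apply Rabs_def1; lra.
Qed.

Lemma seg_near (z a b : pt) (eps l : R) :
  Rabs (fst a - fst z) < eps -> Rabs (snd a - snd z) < eps ->
  Rabs (fst b - fst z) < eps -> Rabs (snd b - snd z) < eps -> 0 <= l <= 1 ->
  Rabs (fst (seg a b l) - fst z) < eps /\ Rabs (snd (seg a b l) - snd z) < eps.
Proof.
  intros H1 H2 H3 H4 Hl. unfold seg; simpl. split; apply convex_comb_near; auto.
Qed.

(* At an interior minimum of f along g, take the first and the last time at which g is at the
   minimizing point z: just before and just after, g is on two points of a straight segment in X
   through z, and strict quasi-concavity makes f smaller at one of them. *)
Lemma no_negative_excursion (X Box : pt -> Prop) (f : pt -> R) (A B : pt) (g : R -> pt) (s t : R) :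
  shortest_curve X A B g -> 0 <= s <= t -> t <= 1 ->
  (forall k1 k2 : R -> R, (forall u, continuity_pt k1 u) -> (forall u, continuity_pt k2 u) ->
     forall u, continuity_pt (fun x => f (k1 x, k2 x)) u) ->
  (forall a b l, Box a -> Box b -> a <> b -> 0 < l < 1 -> Rmin (f a) (f b) < f (seg a b l)) ->
  (forall u, s <= u <= t -> Box (g u)) ->
  (forall u, s <= u <= t -> f (g u) < 0 -> locally (g u) X) ->
  f (g s) = 0 -> f (g t) = 0 ->
  forall u, s <= u <= t -> 0 <= f (g u).
Proof.
  intros Hg Hst Ht Hfc Hq HB HL Es Et u Hu.
  pose proof (proj1 (piecewise_C2_chain g) (proj1 (proj1 Hg))) as Ch.
  destruct (chain_C2_continuous g 0 1 Ch) as (k1 & k2 & c1 & c2 & Hk).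
  destruct (continuity_ab_min (fun x => f (k1 x, k2 x)) s t) as (w & Hmin & Hw); [lra|auto|].
  assert (Hmin' : forall c, s <= c <= t -> f (g w) <= f (g c)).
  { intros c Hc. rewrite !Hk by lra. auto. }
  clear Hmin.
  destruct (Rle_lt_dec 0 (f (g w))) as [P|Neg]; [specialize (Hmin' u Hu); lra|exfalso].
  set (z := g w). set (h := fun x => Rabs (k1 x - fst z) + Rabs (k2 x - snd z)).
  assert (hc : forall x, continuity_pt h x).
  { intros x. apply continuity_pt_plus.
    - apply (continuity_pt_comp (fun x => k1 x - fst z) Rabs); [|apply Rcontinuity_abs].
      apply continuity_pt_minus; auto. apply continuity_pt_const; intros ? ?; auto.
    - apply (continuity_pt_comp (fun x => k2 x - snd z) Rabs); [|apply Rcontinuity_abs].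
      apply continuity_pt_minus; auto. apply continuity_pt_const; intros ? ?; auto. }
  assert (h0 : forall x, 0 <= x <= 1 -> (h x = 0 <-> g x = z)).
  { intros x Hx. unfold h. rewrite (Hk x Hx). split.
    - intros E. pose proof (Rabs_pos (k1 x - fst z)). pose proof (Rabs_pos (k2 x - snd z)).
      assert (E1 : Rabs (k1 x - fst z) = 0) by lra. assert (E2 : Rabs (k2 x - snd z) = 0) by lra.
      rewrite (surjective_pairing z). f_equal; apply Rminus_diag_uniq.
      + destruct (Req_dec (k1 x - fst z) 0); auto. apply Rabs_no_R0 in H1; contradiction.
      + destruct (Req_dec (k2 x - snd z) 0); auto. apply Rabs_no_R0 in H1; contradiction.
    - intros <-. simpl. rewrite !Rminus_diag, Rabs_R0. ring. }
  destruct (first_zero h s w hc) as (v1 & Hv1 & Z1 & F1); [lra|apply h0; auto; lra|].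
  destruct (last_zero h w t hc) as (v2 & Hv2 & Z2 & F2); [lra|apply h0; auto; lra|].
  apply h0 in Z1; [|lra]. apply h0 in Z2; [|lra].
  assert (Ns : s <> v1) by (intros ->; rewrite Z1 in Es; unfold z in Es; lra).
  assert (Nt : t <> v2) by (intros ->; rewrite Z2 in Et; unfold z in Et; lra).
  destruct (HL w Hw Neg) as (eps & Heps). fold z in Heps.
  assert (Hnear : forall v, s <= v <= t -> g v = z -> exists d, 0 < d /\ forall x, s <= x <= t ->
    Rabs (x - v) < d -> Rabs (fst (g x) - fst z) < eps /\ Rabs (snd (g x) - snd z) < eps).
  { intros v Hv Ev. rewrite Hk in Ev by lra.
    destruct (continuity_pt_near k1 v eps (c1 v) (cond_pos eps)) as (d1 & P1 & Q1).
    destruct (continuity_pt_near k2 v eps (c2 v) (cond_pos eps)) as (d2 & P2 & Q2).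
    exists (Rmin d1 d2). split; [apply Rmin_glb_lt; auto|]. intros x Hx Hd.
    rewrite <- Ev, Hk by lra. simpl.
    split; [apply Q1|apply Q2]; (eapply Rlt_le_trans; [exact Hd|]); [apply Rmin_l|apply Rmin_r]. }
  destruct (Hnear v1) as (d1 & P1 & Q1); auto; [lra|].
  destruct (Hnear v2) as (d2 & P2 & Q2); auto; [lra|].
  set (x1 := Rmax s (v1 - d1 / 2)). set (x2 := Rmin t (v2 + d2 / 2)).
  assert (Hx1 : s <= x1 < v1 /\ v1 - d1 / 2 <= x1).
  { unfold x1, Rmax; destruct (Rle_dec s (v1 - d1 / 2)); lra. }
  assert (Hx2 : v2 < x2 <= t /\ x2 <= v2 + d2 / 2).
  { unfold x2, Rmin; destruct (Rle_dec t (v2 + d2 / 2)); lra. }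
  destruct (Q1 x1) as [A1 A2]; [lra|rewrite Rabs_left; lra|].
  destruct (Q2 x2) as [B1 B2]; [lra|rewrite Rabs_right; lra|].
  assert (N1 : g x1 <> z) by (rewrite <- h0 by lra; apply F1; lra).
  assert (N2 : g x2 <> z) by (rewrite <- h0 by lra; apply F2; lra).
  destruct (shortest_in_seg X A B g x1 x2 Hg) with (w := v1) as (l & Hl & El); try lra.
  { intros l Hl. apply Heps. exact (seg_near z (g x1) (g x2) eps l A1 A2 B1 B2 Hl). }
  rewrite Z1 in El.
  assert (Hl' : 0 < l < 1).
  { destruct (Req_dec l 0) as [->|]; [rewrite seg_0 in El; congruence|].
    destruct (Req_dec l 1) as [->|]; [rewrite seg_1 in El; congruence|]. lra. }
  assert (Nab : g x1 <> g x2) by (intros E; rewrite E, seg_same in El; congruence).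
  pose proof (Hq (g x1) (g x2) l ltac:(apply HB; lra) ltac:(apply HB; lra) Nab Hl') as C.
  rewrite <- El in C. unfold z in C.
  pose proof (Hmin' x1 ltac:(lra)). pose proof (Hmin' x2 ltac:(lra)).
  revert C. unfold Rmin; destruct (Rle_dec (f (g x1)) (f (g x2))); lra.
Qed.

Definition cU (th : R) (z : pt) : R := fst z * cos th + snd z * sin th.
Definition cV (th : R) (z : pt) : R := - fst z * sin th + snd z * cos th.
Definition rotinv (th u v : R) : pt := (u * cos th - v * sin th, u * sin th + v * cos th).

Lemma cos_sin_sqr (th : R) : cos th * cos th + sin th * sin th = 1.
Proof. pose proof (sin2_cos2 th) as H. unfold Rsqr in H. lra. Qed.

Lemma cU_rotinv (th u v : R) : cU th (rotinv th u v) = u.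
Proof.
  unfold cU, rotinv; simpl. transitivity (u * (cos th * cos th + sin th * sin th)); [ring|].
  rewrite cos_sin_sqr; ring.
Qed.

Lemma cV_rotinv (th u v : R) : cV th (rotinv th u v) = v.
Proof.
  unfold cV, rotinv; simpl. transitivity (v * (cos th * cos th + sin th * sin th)); [ring|].
  rewrite cos_sin_sqr; ring.
Qed.

Lemma rotinv_cUV (th : R) (z : pt) : rotinv th (cU th z) (cV th z) = z.
Proof.
  destruct z as [x y]; unfold rotinv, cU, cV; simpl. pose proof (cos_sin_sqr th) as H. f_equal.
  - transitivity (x * (cos th * cos th + sin th * sin th)); [ring|]. rewrite H; ring.
  - transitivity (y * (cos th * cos th + sin th * sin th)); [ring|]. rewrite H; ring.
Qed.

Lemma cUV_inj (th : R) (z w : pt) : cU th z = cU th w -> cV th z = cV th w -> z = w.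
Proof. intros E1 E2. rewrite <- (rotinv_cUV th z), <- (rotinv_cUV th w), E1, E2; auto. Qed.

Lemma cU_seg (th : R) (a b : pt) (l : R) : cU th (seg a b l) = (1 - l) * cU th a + l * cU th b.
Proof. unfold cU, seg; simpl; ring. Qed.

Lemma cV_seg (th : R) (a b : pt) (l : R) : cV th (seg a b l) = (1 - l) * cV th a + l * cV th b.
Proof. unfold cV, seg; simpl; ring. Qed.

Lemma continuity_pt_cst (c x : R) : continuity_pt (fun _ => c) x.
Proof. apply continuity_pt_const; intros ? ?; auto. Qed.

Lemma cU_continuity (th : R) (k1 k2 : R -> R) (x : R) :
  continuity_pt k1 x -> continuity_pt k2 x -> continuity_pt (fun s => cU th (k1 s, k2 s)) x.
Proof.
  intros. apply (continuity_pt_plus (fun s => k1 s * cos th) (fun s => k2 s * sin th));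
  [apply (continuity_pt_mult k1 (fun _ => cos th))|apply (continuity_pt_mult k2 (fun _ => sin th))];
  auto using continuity_pt_cst.
Qed.

Lemma cV_continuity (th : R) (k1 k2 : R -> R) (x : R) :
  continuity_pt k1 x -> continuity_pt k2 x -> continuity_pt (fun s => cV th (k1 s, k2 s)) x.
Proof.
  intros. apply (continuity_pt_plus (fun s => - k1 s * sin th) (fun s => k2 s * cos th));
  [apply (continuity_pt_mult (fun s => - k1 s) (fun _ => sin th))
  |apply (continuity_pt_mult k2 (fun _ => cos th))];
  auto using continuity_pt_cst. apply continuity_pt_opp; auto.
Qed.

Lemma peval_continuity (p : rpoly) (x : R) : continuity_pt (peval p) x.
Proof.
  induction p as [|c p IH]; [apply continuity_pt_cst|].
  apply (continuity_pt_plus (fun _ => c) (fun x => x * peval p x)); [apply continuity_pt_cst|].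
  apply (continuity_pt_mult (fun x => x) (peval p)); auto.
  apply derivable_continuous_pt, derivable_pt_id.
Qed.

Lemma nat_interval_cover (m : nat) (x : R) :
  0 <= x <= INR (S m) -> exists k, (k < S m)%nat /\ INR k <= x <= INR k + 1.
Proof.
  induction m as [|m IH]; intros Hx.
  - exists 0%nat. simpl in *. split; [lia|lra].
  - destruct (Rle_lt_dec x (INR (S m))) as [L|L].
    + destruct IH as (k & Hk & Hx'); [lra|]. exists k. split; [lia|auto].
    + exists (S m). split; [lia|]. rewrite S_INR in Hx. lra.
Qed.

Definition box (th u0 v0 r : R) (z : pt) : Prop :=
  Rabs (cU th z - u0) < r /\ Rabs (cV th z - v0) < r.

Lemma box_seg (th u0 v0 r : R) (a b : pt) (l : R) :
  box th u0 v0 r a -> box th u0 v0 r b -> 0 <= l <= 1 -> box th u0 v0 r (seg a b l).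
Proof.
  intros [H1 H2] [H3 H4] Hl. unfold box. rewrite cU_seg, cV_seg.
  split; apply convex_comb_near; auto.
Qed.

Definition arc (p : rpoly) (th : R) (K : R -> Prop) (z : pt) : Prop :=
  cV th z = peval p (cU th z) /\ K (cU th z).

Lemma arc_interacts (X : pt -> Prop) (p : rpoly) (th u0 v0 r sg : R) (K : R -> Prop)
  (A B : pt) (g : R -> pt) :
  shortest_curve X A B g -> sg * sg = 1 -> convex_R K ->
  (forall u, K u -> Rabs (u - u0) < r / 2 /\ Rabs (peval p u - v0) < r / 2) ->
  (forall a b l, Rabs (a - u0) < r -> Rabs (b - u0) < r -> a <> b -> 0 < l < 1 ->
     sg * peval p ((1 - l) * a + l * b) < (1 - l) * (sg * peval p a) + l * (sg * peval p b)) ->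
  let f z := sg * (cV th z - peval p (cU th z)) in
  (forall z, box th u0 v0 r z -> f z = 0 -> X z) ->
  ((forall z, box th u0 v0 r z -> 0 < f z -> X z) \/
   (forall z, box th u0 v0 r z -> 0 < f z -> ~ X z)) ->
  (forall z, box th u0 v0 r z -> f z < 0 -> X z -> locally z X) ->
  exists N, interacts_at_most g (arc p th K) N.
Proof.
  intros Hg Hsg HK Hnear Hconv f H0 Hside Hneg.
  assert (Hsg0 : sg <> 0) by (intros ->; lra).
  assert (f0 : forall z, f z = 0 <-> cV th z = peval p (cU th z)).
  { intros z; unfold f; split; intros E; [|rewrite E; ring].
    apply Rmult_integral in E. destruct E; [contradiction|lra]. }
  assert (Hbox : forall z, arc p th K z -> box th u0 v0 r z).
  { intros z [E HKz]. destruct (Hnear _ HKz). rewrite <- E in H1.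
    pose proof (Rabs_pos (cU th z - u0)). split; lra. }
  assert (Hq : forall a b l, box th u0 v0 r a -> box th u0 v0 r b -> a <> b -> 0 < l < 1 ->
    Rmin (f a) (f b) < f (seg a b l)).
  { intros a b l Ha Hb Nab Hl.
    destruct (Req_dec (cU th a) (cU th b)) as [Eu|Nu].
    - assert (Nv : cV th a <> cV th b) by (intros E; apply Nab, (cUV_inj th); auto).
      unfold f. rewrite cU_seg, cV_seg, Eu.
      replace ((1 - l) * cU th b + l * cU th b) with (cU th b) by ring.
      set (x := sg * (cV th a - peval p (cU th b))). set (y := sg * (cV th b - peval p (cU th b))).
      assert (Nxy : x <> y).
      { unfold x, y. intros E. apply Rmult_eq_reg_l in E; auto. apply Nv; lra. }
      replace (sg * _) with ((1 - l) * x + l * y) by (unfold x, y; ring).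
      unfold Rmin; destruct (Rle_dec x y); nra.
    - pose proof (Hconv (cU th a) (cU th b) l (proj1 Ha) (proj1 Hb) Nu Hl) as C.
      assert (C' : (1 - l) * f a + l * f b < f (seg a b l)).
      { unfold f. rewrite cU_seg, cV_seg. lra. }
      unfold Rmin; destruct (Rle_dec (f a) (f b)); nra. }
  destruct Hside as [Hpos|Hpos].
  - apply (interacts_two_values X (arc p th K) A B g Hg).
    + intros a b l Ha Hb Hl.
      assert (Xa : forall z, arc p th K z -> X z).
      { intros z Hz. apply H0; [auto|]. apply f0, Hz. }
      destruct (classic (a = b)) as [->|Nab]; [rewrite seg_same; auto|].
      destruct (Req_dec l 0) as [->|N0]; [rewrite seg_0; auto|].
      destruct (Req_dec l 1) as [->|N1]; [rewrite seg_1; auto|].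
      apply Hpos; [apply box_seg; auto|].
      eapply Rle_lt_trans; [|apply Hq; auto; lra].
      rewrite (proj2 (f0 a)), (proj2 (f0 b)) by (apply Ha || apply Hb).
      rewrite Rmin_left; lra.
    + intros a b l Ha Hb Hl Hs.
      destruct (classic (a = b)) as [->|Nab]; [rewrite seg_same; auto|].
      destruct (Req_dec l 0) as [->|N0]; [rewrite seg_0; auto|].
      destruct (Req_dec l 1) as [->|N1]; [rewrite seg_1; auto|].
      assert (Rmin (f a) (f b) < f (seg a b l)) as C by (apply Hq; auto; lra).
      rewrite (proj2 (f0 a)), (proj2 (f0 b)), (proj2 (f0 (seg a b l))) in C
        by (apply Ha || apply Hb || apply Hs).
      rewrite Rmin_left in C; lra.
  - pose proof (proj1 (piecewise_C2_chain g) (proj1 (proj1 Hg))) as Ch.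
    destruct (chain_C2_continuous g 0 1 Ch) as (k1 & k2 & c1 & c2 & Hk).
    set (x := fun s => cU th (k1 s, k2 s)). set (y := fun s => cV th (k1 s, k2 s)).
    assert (cx : forall s, continuity_pt x s) by (intros; apply cU_continuity; auto).
    assert (cy : forall s, continuity_pt y s) by (intros; apply cV_continuity; auto).
    assert (Hx : forall s, 0 <= s <= 1 -> cU th (g s) = x s) by (intros s Hs; rewrite Hk; auto).
    assert (Hy : forall s, 0 <= s <= 1 -> cV th (g s) = y s) by (intros s Hs; rewrite Hk; auto).
    destruct (Rle_lt_dec r 0) as [Hr|Hr].
    { exists 0%nat, (fun _ _ => False). split; [intros; lia|].
      intros s; split; [|intros (k & Hk' & _); lia].
      intros [_ Hs]. apply Hbox in Hs. destruct Hs as [Hs _].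
      pose proof (Rabs_pos (cU th (g s) - u0)). lra. }
    assert (Hr2 : 0 < r / 2) by lra.
    destruct (@Heine_cor2 x 0 1 (fun s _ => cx s) (mkposreal _ Hr2)) as [d1 U1].
    destruct (@Heine_cor2 y 0 1 (fun s _ => cy s) (mkposreal _ Hr2)) as [d2 U2].
    simpl in U1, U2.
    set (d := Rmin d1 d2).
    assert (Hd : 0 < d) by (apply Rmin_glb_lt; apply cond_pos).
    destruct (archimed_cor1 d Hd) as (N & HN & HN0).
    assert (HNR : 0 < INR N) by (apply lt_0_INR; auto).
    exists N, (fun k s => (0 <= s <= 1 /\ arc p th K (g s)) /\ INR k <= s * INR N <= INR k + 1).
    split.
    + intros k _ s t w [[Hs As] Ks] [[Ht At] Kt] Hw.
      assert (Hst : Rabs (t - s) < d).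
      { rewrite Rabs_right by lra. apply Rle_lt_trans with (/ INR N); auto.
        apply Rmult_le_reg_r with (INR N); auto. rewrite Rinv_l by lra. lra. }
      assert (Hb : forall u, s <= u <= t -> box th u0 v0 r (g u)).
      { intros u Hu. destruct As as [E HKs]. destruct (Hnear _ HKs) as [B1 B2].
        rewrite <- E in B2.
        assert (Hus : Rabs (u - s) < d).
        { rewrite Rabs_right in Hst by lra. rewrite Rabs_right; lra. }
        assert (V1 : Rabs (x u - x s) < r / 2).
        { apply U1; try lra. eapply Rlt_le_trans; [exact Hus|apply Rmin_l]. }
        assert (V2 : Rabs (y u - y s) < r / 2).
        { apply U2; try lra. eapply Rlt_le_trans; [exact Hus|apply Rmin_r]. }
        rewrite <- !Hx in V1 by lra. rewrite <- !Hy in V2 by lra.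
        apply Rabs_def2 in B1, B2, V1, V2. split; apply Rabs_def1; lra. }
      assert (Hon : forall u, s <= u <= t -> f (g u) = 0).
      { intros u Hu. apply Rle_antisym.
        - apply Rnot_lt_le. intros C. apply (Hpos (g u)); auto. apply (proj1 Hg); lra.
        - apply (no_negative_excursion X (box th u0 v0 r) f A B g s t); auto; try lra.
          + intros j1 j2 e1 e2 v. apply (continuity_pt_mult (fun _ => sg)
              (fun s => cV th (j1 s, j2 s) - peval p (cU th (j1 s, j2 s))));
              [apply continuity_pt_cst|].
            apply continuity_pt_minus; [apply cV_continuity; auto|].
            apply (continuity_pt_comp (fun s => cU th (j1 s, j2 s)) (peval p));
              [apply cU_continuity; auto|apply peval_continuity].
          + intros v Hv Nv. apply Hneg; auto. apply (proj1 Hg); lra.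
          + apply f0, As.
          + apply f0, At. }
      assert (Hinj : forall a b, s <= a <= t -> s <= b <= t -> x a = x b -> g a = g b).
      { intros a b Ha Hb' E. apply (cUV_inj th).
        - rewrite !Hx by lra; auto.
        - rewrite (proj1 (f0 (g a)) (Hon a Ha)), (proj1 (f0 (g b)) (Hon b Hb')), !Hx by lra.
          rewrite E; auto. }
      split; [split; [lra|split]|nra].
      { apply f0, Hon; auto. }
      destruct As as [_ Ks']. destruct At as [_ Kt'].
      rewrite Hx in Ks', Kt' |- * by lra.
      assert (Cases : Rmin (x s) (x w) <= x t <= Rmax (x s) (x w) \/
                      Rmin (x w) (x t) <= x s <= Rmax (x w) (x t) \/
                      (x s <= x w <= x t \/ x t <= x w <= x s)).
      { unfold Rmin, Rmax. destruct (Rle_dec (x s) (x w)), (Rle_dec (x w) (x t)); 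
        try (right; right; lra);
        destruct (Rle_dec (x s) (x t)); [left|right;left|right;left|left]; lra. }
      destruct Cases as [C|[C|[C|C]]].
      * destruct (IVT_gen x s w (x t)) as (c & Hc & Ec); [intros ?; apply cx|exact C|].
        rewrite Rmin_left, Rmax_right in Hc by lra.
        assert (E : g c = g t) by (apply Hinj; auto; lra).
        assert (Ew : g w = g c) by (apply (shortest_const X A B g c t w); auto; lra).
        rewrite <- Hx, Ew, Hx, Ec by lra. auto.
      * destruct (IVT_gen x w t (x s)) as (c & Hc & Ec); [intros ?; apply cx|exact C|].
        rewrite Rmin_left, Rmax_right in Hc by lra.
        assert (E : g s = g c) by (apply Hinj; auto; lra).
        assert (Ew : g w = g s) by (apply (shortest_const X A B g s c w); auto; lra).
        rewrite <- Hx, Ew, Hx by lra. auto.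
      * apply (HK (x s) (x t)); auto.
      * apply (HK (x t) (x s)); auto.
    + intros s; split; [|intros (k & _ & H & _); exact H].
      intros H. destruct N as [|m]; [lia|].
      destruct (nat_interval_cover m (s * INR (S m))) as (k & Hk' & Hs).
      { destruct H as [H _]. split; [apply Rmult_le_pos; lra|].
        rewrite <- (Rmult_1_l (INR (S m))) at 2. apply Rmult_le_compat_r; lra. }
      exists k. auto.
Qed.

(** * Local structure along polynomial graphs *)

Lemma peval_nil (x : R) : peval nil x = 0.
Proof. reflexivity. Qed.

Lemma peval_cons (c : R) (p : rpoly) (x : R) : peval (c :: p) x = c + x * peval p x.
Proof. reflexivity. Qed.

Lemma rpoly_add (p q : rpoly) : exists r : rpoly, forall x, peval r x = peval p x + peval q x.
Proof.
  revert q. induction p as [|c p IH]; intros q.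
  - exists q. intros; rewrite ?peval_cons, ?peval_nil; ring.
  - destruct q as [|d q].
    + exists (c :: p). intros; rewrite ?peval_cons, ?peval_nil; ring.
    + destruct (IH q) as (r & Hr). exists (c + d :: r). intros x. rewrite !peval_cons, Hr. ring.
Qed.

Lemma rpoly_mul (p q : rpoly) : exists r : rpoly, forall x, peval r x = peval p x * peval q x.
Proof.
  induction p as [|c p (r & Hr)].
  - exists nil. intros; rewrite ?peval_cons, ?peval_nil; ring.
  - assert (S : exists s : rpoly, forall x, peval s x = c * peval q x).
    { exists (map (Rmult c) q). intros x. clear. induction q as [|d q IH]; [rewrite !peval_nil; ring|].
      simpl map. rewrite !peval_cons, IH. ring. }
    destruct S as (s & Hs). destruct (rpoly_add s (0 :: r)) as (t & Ht).
    exists t. intros x. rewrite Ht, Hs, !peval_cons, Hr. ring.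
Qed.

Lemma rpoly_comp (p q : rpoly) : exists r : rpoly, forall x, peval r x = peval p (peval q x).
Proof.
  induction p as [|c p (r & Hr)].
  - exists nil. auto.
  - destruct (rpoly_mul q r) as (m & Hm). destruct (rpoly_add (c :: nil) m) as (t & Ht).
    exists t. intros x. rewrite Ht, Hm, Hr, !peval_cons, peval_nil. ring.
Qed.

Lemma rpoly_factor (p : rpoly) (a : R) :
  exists r : rpoly, length r = pred (length p) /\
    forall x, peval p x = peval p a + (x - a) * peval r x.
Proof.
  induction p as [|c p (r & Hl & Hr)].
  - exists nil. split; auto. intros; rewrite ?peval_cons, ?peval_nil; ring.
  - destruct p as [|d p].
    + exists nil. split; auto. intros; rewrite ?peval_cons, ?peval_nil; ring.
    + exists (peval (d :: p) a :: r). split; [simpl in *; lia|]. intros x.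
      change (c + x * peval (d :: p) x =
        c + a * peval (d :: p) a + (x - a) * (peval (d :: p) a + x * peval r x)).
      rewrite (Hr x). ring.
Qed.

Lemma rpoly_roots (p : rpoly) :
  exists L : list R, forall x, peval p x = 0 -> In x L \/ forall y, peval p y = 0.
Proof.
  remember (length p) as n eqn:En. revert p En.
  induction n as [|n IH]; intros p En.
  - exists nil. intros x _. right. destruct p; [auto|discriminate].
  - destruct (classic (exists a, peval p a = 0)) as [(a & Ha)|No].
    + destruct (rpoly_factor p a) as (r & Hl & Hr).
      destruct (IH r) as (L & HL); [lia|].
      exists (a :: L). intros x Hx. rewrite Hr, Ha in Hx.
      destruct (Req_dec x a) as [->|N]; [left; left; auto|].
      destruct (HL x) as [I|Z].
      * apply Rmult_eq_reg_l with (x - a); lra.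
      * left; right; auto.
      * right. intros y. rewrite Hr, Ha, Z. ring.
    + exists nil. intros x Hx. exfalso; eauto.
Qed.

Lemma rpoly_derive (p : rpoly) : exists q : rpoly, forall x, is_derive (peval p) x (peval q x).
Proof.
  induction p as [|c p (q & Hq)].
  - exists nil. intros x. apply (is_derive_const 0 x).
  - destruct (rpoly_add p (0 :: q)) as (r & Hr). exists r. intros x. rewrite Hr.
    apply (is_derive_ext (fun x => c + x * peval p x)); [reflexivity|].
    evar_last.
    + apply (is_derive_plus (fun _ => c) (fun x => x * peval p x)); [apply (is_derive_const c x)|].
      apply (is_derive_mult (fun x => x) (peval p)); [apply (is_derive_id x)|apply Hq|].
      intros; apply Rmult_comm.
    + rewrite peval_cons. unfold plus, zero, mult, one; simpl. ring.
Qed.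

Lemma strictly_convex_of_derive2 (h h1 h2 : R -> R) (u0 r : R) :
  (forall x, is_derive h x (h1 x)) -> (forall x, is_derive h1 x (h2 x)) ->
  (forall x, Rabs (x - u0) < r -> 0 < h2 x) ->
  forall a b l, Rabs (a - u0) < r -> Rabs (b - u0) < r -> a <> b -> 0 < l < 1 ->
    h ((1 - l) * a + l * b) < (1 - l) * h a + l * h b.
Proof.
  intros D1 D2 P.
  assert (G : forall a b l, Rabs (a - u0) < r -> Rabs (b - u0) < r -> a < b -> 0 < l < 1 ->
    h ((1 - l) * a + l * b) < (1 - l) * h a + l * h b).
  { intros a b l Ha Hb Hab Hl. set (c := (1 - l) * a + l * b).
    assert (0 < l * (b - a)) by (apply Rmult_lt_0_compat; lra).
    assert (0 < (1 - l) * (b - a)) by (apply Rmult_lt_0_compat; lra).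
    assert (Hac : a < c) by (unfold c; lra). assert (Hcb : c < b) by (unfold c; lra).
    destruct (MVT_cor2 h h1 a c Hac) as (x1 & E1 & I1); [intros; apply is_derive_Reals, D1|].
    destruct (MVT_cor2 h h1 c b Hcb) as (x2 & E2 & I2); [intros; apply is_derive_Reals, D1|].
    destruct (MVT_cor2 h1 h2 x1 x2) as (x3 & E3 & I3); [lra|intros; apply is_derive_Reals, D2|].
    assert (0 < h2 x3) by (apply P; apply Rabs_def2 in Ha, Hb; apply Rabs_def1; lra).
    assert (0 < h2 x3 * (x2 - x1)) by (apply Rmult_lt_0_compat; lra).
    replace (c - a) with (l * (b - a)) in E1 by (unfold c; ring).
    replace (b - c) with ((1 - l) * (b - a)) in E2 by (unfold c; ring).
    assert (0 < (l * (b - a)) * (1 - l) * (h1 x2 - h1 x1)).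
    { repeat apply Rmult_lt_0_compat; lra. }
    nra. }
  intros a b l Ha Hb N Hl. destruct (Rtotal_order a b) as [L|[E|L]]; [auto|contradiction|].
  replace ((1 - l) * a + l * b) with ((1 - (1 - l)) * b + (1 - l) * a) by ring.
  replace ((1 - l) * h a + l * h b) with ((1 - (1 - l)) * h b + (1 - l) * h a) by ring.
  apply G; auto; lra.
Qed.

Lemma affine_of_derive2 (h h1 : R -> R) :
  (forall x, is_derive h x (h1 x)) -> (forall x, is_derive h1 x 0) ->
  forall x, h x = h 0 + h1 0 * x.
Proof.
  assert (Z : forall k : R -> R, (forall x, is_derive k x 0) -> forall x, k x = k 0).
  { intros k Dk x. destruct (MVT_gen k 0 x (fun _ => 0)) as (c & _ & E); auto.
    - intros y _. apply continuity_pt_filterlim, (ex_derive_continuous k). eexists; apply Dk.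
    - lra. }
  intros D1 D2 x.
  assert (E : h x - h1 0 * x = h 0 - h1 0 * 0).
  { apply (Z (fun x => h x - h1 0 * x)). intros y. evar_last.
    - apply (is_derive_minus h (fun x => h1 0 * x)); [apply D1|].
      apply (is_derive_scal (fun x => x)), (is_derive_id y).
    - rewrite (Z h1 D2 y). unfold minus, plus, opp, one, scal, mult; simpl. ring. }
  lra.
Qed.

Definition same_sign (a b : R) : Prop :=
  (0 < a /\ 0 < b) \/ (a = 0 /\ b = 0) \/ (a < 0 /\ b < 0).

Lemma same_sign_mult (c d D x y : R) :
  0 < c * D -> 0 < d * D -> same_sign x y -> same_sign (c * x) (d * y).
Proof.
  intros Hc Hd. unfold same_sign.
  assert (C : (0 < c /\ 0 < d) \/ (c < 0 /\ d < 0)).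
  { destruct (Rtotal_order D 0) as [L|[->|L]]; [right|lra|left]; split; nra. }
  intros [[H1 H2]|[[-> ->]|[H1 H2]]].
  - destruct C; [left|right; right]; split; nra.
  - right; left; split; ring.
  - destruct C; [right; right|left]; split; nra.
Qed.

Lemma same_sign_near (x y z : R) :
  z <> 0 -> Rabs (x - z) < Rabs z -> Rabs (y - z) < Rabs z -> same_sign x y.
Proof.
  intros N Hx Hy. unfold same_sign. apply Rabs_def2 in Hx, Hy.
  destruct (Rle_lt_dec 0 z).
  - rewrite Rabs_right in Hx, Hy by lra. left; lra.
  - rewrite Rabs_left in Hx, Hy by lra. right; right; lra.
Qed.

Lemma cU_change (th be : R) (z : pt) :
  cU be z = cos (be - th) * cU th z + sin (be - th) * cV th z.
Proof.
  rewrite cos_minus, sin_minus. unfold cU, cV. pose proof (cos_sin_sqr th) as H.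
  transitivity ((cos th * cos th + sin th * sin th) * (fst z * cos be + snd z * sin be)); [|ring].
  rewrite H; ring.
Qed.

Lemma cV_change (th be : R) (z : pt) :
  cV be z = - sin (be - th) * cU th z + cos (be - th) * cV th z.
Proof.
  rewrite cos_minus, sin_minus. unfold cU, cV. pose proof (cos_sin_sqr th) as H.
  transitivity ((cos th * cos th + sin th * sin th) * (- fst z * sin be + snd z * cos be)); [|ring].
  rewrite H; ring.
Qed.

Lemma Phi_cUV (f : rpoly) (th : R) (z : pt) : Phi f th z = peval f (cU th z) - cV th z.
Proof. reflexivity. Qed.

Lemma cos_sin_comb_lt (al x y d : R) :
  Rabs x < d / 2 -> Rabs y < d / 2 -> Rabs (cos al * x + sin al * y) < d.
Proof.
  intros Hx Hy. eapply Rle_lt_trans; [apply Rabs_triang|]. rewrite !Rabs_mult.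
  pose proof (Rabs_pos x). pose proof (Rabs_pos y).
  assert (Rabs (cos al) <= 1) by (apply Rabs_le; apply COS_bound).
  assert (Rabs (sin al) <= 1) by (apply Rabs_le; apply SIN_bound).
  assert (Rabs (cos al) * Rabs x <= 1 * Rabs x) by (apply Rmult_le_compat_r; auto).
  assert (Rabs (sin al) * Rabs y <= 1 * Rabs y) by (apply Rmult_le_compat_r; auto). lra.
Qed.

Definition graph_pt (p : rpoly) (th u : R) : pt := rotinv th u (peval p u).

Lemma Phi_local_nonzero (f p : rpoly) (th be u0 : R) :
  Phi f be (graph_pt p th u0) <> 0 ->
  exists r, 0 < r /\ forall z z', box th u0 (peval p u0) r z -> box th u0 (peval p u0) r z' ->
    same_sign (Phi f be z) (Phi f be z').
Proof.
  intros N. set (z0 := graph_pt p th u0) in *. set (eps := Rabs (Phi f be z0)).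
  assert (He : 0 < eps) by (apply Rabs_pos_lt; auto).
  destruct (continuity_pt_near (peval f) (cU be z0) (eps / 2)) as (d & Hd & Hc);
    [apply peval_continuity|lra|].
  exists (Rmin (d / 2) (eps / 4)). split; [apply Rmin_glb_lt; lra|].
  assert (G : forall z, box th u0 (peval p u0) (Rmin (d / 2) (eps / 4)) z ->
    Rabs (Phi f be z - Phi f be z0) < eps).
  { intros z [H1 H2].
    assert (E1 : cU th z0 = u0) by apply cU_rotinv.
    assert (E2 : cV th z0 = peval p u0) by apply cV_rotinv.
    rewrite <- E1 in H1 at 1. rewrite <- E2 in H2 at 1.
    pose proof (Rmin_l (d / 2) (eps / 4)). pose proof (Rmin_r (d / 2) (eps / 4)).
    assert (K1 : Rabs (cU be z - cU be z0) < d).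
    { rewrite (cU_change th be z), (cU_change th be z0).
      replace (_ - _) with (cos (be - th) * (cU th z - cU th z0) + sin (be - th) * (cV th z - cV th z0)) by ring.
      apply cos_sin_comb_lt; lra. }
    assert (K2 : Rabs (cV be z - cV be z0) < eps / 2).
    { rewrite (cV_change th be z), (cV_change th be z0).
      replace (_ - _) with (cos (be - th) * (cV th z - cV th z0) + sin (be - th) * (- (cU th z - cU th z0))) by ring.
      apply cos_sin_comb_lt; [|rewrite Rabs_Ropp]; lra. }
    specialize (Hc _ K1). rewrite !Phi_cUV. apply Rabs_def2 in Hc, K2. apply Rabs_def1; lra. }
  intros z z' Hz Hz'. apply same_sign_near with (Phi f be z0); auto; apply G; auto.
Qed.

(* If Phi_{f,be} vanishes along the graph of p, then its gradient, which never vanishes, is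
   normal to the graph; so its derivative across the graph is nonzero. *)
Lemma Phi_local_zero (f p : rpoly) (th be u0 : R) :
  (forall u, Phi f be (graph_pt p th u) = 0) ->
  exists r, 0 < r /\ forall z z', box th u0 (peval p u0) r z -> box th u0 (peval p u0) r z' ->
    same_sign (cV th z - peval p (cU th z)) (cV th z' - peval p (cU th z')) ->
    same_sign (Phi f be z) (Phi f be z').
Proof.
  intros Z. set (a := cos (be - th)). set (b := sin (be - th)).
  set (F := fun u v => peval f (a * u + b * v) - (- b * u + a * v)).
  assert (HF : forall z, Phi f be z = F (cU th z) (cV th z)).
  { intros z. rewrite Phi_cUV, (cU_change th be), (cV_change th be). reflexivity. }
  assert (HF0 : forall u, F u (peval p u) = 0).
  { intros u. rewrite <- (Z u), HF. unfold graph_pt. rewrite cU_rotinv, cV_rotinv. reflexivity. }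
  destruct (rpoly_derive f) as (q & Hq). destruct (rpoly_derive p) as (p1 & Hp1).
  set (v0 := peval p u0) in *. set (w0 := a * u0 + b * v0).
  set (D := b * peval q w0 - a).
  assert (ND : D <> 0).
  { assert (HD : is_derive (fun u => F u (peval p u)) u0
      (peval q w0 * (a + b * peval p1 u0) - (- b + a * peval p1 u0))).
    { unfold F. evar_last.
      - apply (is_derive_minus (fun u => peval f (a * u + b * peval p u))
                 (fun u => - b * u + a * peval p u)).
        + apply (is_derive_comp (peval f) (fun u => a * u + b * peval p u)); [apply Hq|].
          apply (is_derive_plus (fun u => a * u) (fun u => b * peval p u)).
          * apply (is_derive_scal (fun u => u)), (is_derive_id u0).
          * apply (is_derive_scal (peval p)), Hp1.
        + apply (is_derive_plus (fun u => - b * u) (fun u => a * peval p u)).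
          * apply (is_derive_scal (fun u => u)), (is_derive_id u0).
          * apply (is_derive_scal (peval p)), Hp1.
      - unfold minus, plus, opp, scal, mult, one; simpl. unfold mult; simpl. unfold w0, v0. ring. }
    assert (HD0 : is_derive (fun u => F u (peval p u)) u0 0).
    { apply (is_derive_ext (fun _ => 0)); [intros; rewrite HF0; auto|apply (is_derive_const 0 u0)]. }
    apply is_derive_unique in HD. apply is_derive_unique in HD0. rewrite HD in HD0.
    intros E. unfold D in E. set (k := peval q w0) in *.
    assert (a * a + b * b = 1) by (unfold a, b; apply cos_sin_sqr).
    assert (Ek : k * a + b = 0) by nra.
    assert (b * (k * k + 1) = 0) by nra.
    assert (b = 0) by (apply Rmult_integral in H0; destruct H0; [auto|nra]).
    nra. }
  destruct (continuity_pt_near (fun w => b * peval q w - a) w0 (Rabs D)) as (d & Hd & Hc).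
  { apply continuity_pt_minus; [|apply continuity_pt_cst].
    apply (continuity_pt_mult (fun _ => b) (peval q)); [apply continuity_pt_cst|apply peval_continuity]. }
  { apply Rabs_pos_lt; auto. }
  fold D in Hc.
  destruct (continuity_pt_near (peval p) u0 (d / 2)) as (d' & Hd' & Hc');
    [apply peval_continuity|lra|]. fold v0 in Hc'.
  exists (Rmin d' (d / 2)). split; [apply Rmin_glb_lt; lra|].
  assert (G : forall z, box th u0 v0 (Rmin d' (d / 2)) z -> exists c, 0 < c * D /\
    Phi f be z = c * (cV th z - peval p (cU th z))).
  { intros z [H1 H2]. rewrite HF. set (u := cU th z) in *. set (v := cV th z) in *.
    pose proof (Rmin_l d' (d / 2)). pose proof (Rmin_r d' (d / 2)).
    assert (K : Rabs (peval p u - v0) < d / 2) by (apply Hc'; lra).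
    destruct (MVT_gen (F u) (peval p u) v (fun y => b * peval q (a * u + b * y) - a))
      as (y & Hy & Ey).
    - intros x _. unfold F. evar_last.
      + apply (is_derive_minus (fun y => peval f (a * u + b * y)) (fun y => - b * u + a * y)).
        * apply (is_derive_comp (peval f) (fun y => a * u + b * y)); [apply Hq|].
          apply (is_derive_plus (fun _ => a * u) (fun y => b * y)); [apply (is_derive_const (a * u) x)|].
          apply (is_derive_scal (fun u => u)), (is_derive_id x).
        * apply (is_derive_plus (fun _ => - b * u) (fun y => a * y)); [apply (is_derive_const (- b * u) x)|].
          apply (is_derive_scal (fun u => u)), (is_derive_id x).
      + unfold minus, plus, opp, scal, mult, one, zero; simpl. unfold mult; simpl. ring.
    - intros x _. unfold F. apply continuity_pt_minus.
      + apply (continuity_pt_comp (fun y => a * u + b * y) (peval f)); [|apply peval_continuity].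
        apply derivable_continuous_pt. reg.
      + apply derivable_continuous_pt. reg.
    - rewrite HF0 in Ey. exists (b * peval q (a * u + b * y) - a). split; [|lra].
      assert (Ky : Rabs (y - v0) < d / 2).
      { apply Rabs_def2 in K, H2. revert Hy. unfold Rmin, Rmax.
        destruct (Rle_dec (peval p u) v); intros; apply Rabs_def1; lra. }
      assert (Kw : Rabs (a * u + b * y - w0) < d).
      { unfold w0. replace (_ - _) with (a * (u - u0) + b * (y - v0)) by ring.
        apply cos_sin_comb_lt; lra. }
      specialize (Hc _ Kw). apply Rabs_def2 in Hc.
      destruct (Rle_lt_dec 0 D).
      + rewrite Rabs_right in Hc by lra. apply Rmult_lt_0_compat; lra.
      + rewrite Rabs_left in Hc by lra. nra. }
  intros z z' Hz Hz' S. destruct (G z Hz) as (c & Pc & ->). destruct (G z' Hz') as (c' & Pc' & ->).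
  apply same_sign_mult with D; auto.
Qed.

Definition generic_param (Q : list (rpoly * R)) (p : rpoly) (th u0 : R) : Prop :=
  forall fb, In fb Q -> Phi (fst fb) (snd fb) (graph_pt p th u0) <> 0 \/
    forall u, Phi (fst fb) (snd fb) (graph_pt p th u) = 0.

Lemma generic_param_cofinite (Q : list (rpoly * R)) (p : rpoly) (th : R) :
  exists L : list R, forall u0, ~ In u0 L -> generic_param Q p th u0.
Proof.
  induction Q as [|[f be] Q (L & HL)].
  - exists nil. intros u0 _ fb [].
  - assert (E : exists q : rpoly, forall u, peval q u = Phi f be (graph_pt p th u)).
    { destruct (rpoly_mul (sin (be - th) :: nil) p) as (q1 & H1).
      destruct (rpoly_add (0 :: cos (be - th) :: nil) q1) as (q2 & H2).
      destruct (rpoly_comp f q2) as (q3 & H3).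
      destruct (rpoly_mul (- cos (be - th) :: nil) p) as (q4 & H4).
      destruct (rpoly_add (0 :: sin (be - th) :: nil) q4) as (q5 & H5).
      destruct (rpoly_add q3 q5) as (q & H6).
      exists q. intros u. rewrite H6, H3, H2, H1, H5, H4, Phi_cUV, (cU_change th be), (cV_change th be).
      unfold graph_pt. rewrite cU_rotinv, cV_rotinv, !peval_cons, !peval_nil. unfold Rminus. f_equal; [f_equal|]; ring. }
    destruct E as (q & Hq). destruct (rpoly_roots q) as (M & HM).
    exists (M ++ L). intros u0 N fb [<-|I].
    + simpl. destruct (Req_dec (peval q u0) 0) as [Z|NZ].
      * right. intros u. rewrite <- Hq. destruct (HM u0 Z); [|auto].
        exfalso; apply N, in_or_app; auto.
      * left. rewrite <- Hq. auto.
    + apply HL; auto. intros I'; apply N, in_or_app; auto.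
Qed.

Lemma box_le (th u0 v0 r r' : R) (z : pt) : r <= r' -> box th u0 v0 r z -> box th u0 v0 r' z.
Proof. intros H [H1 H2]. split; lra. Qed.

Lemma signs_local (Q : list (rpoly * R)) (p : rpoly) (th u0 : R) :
  generic_param Q p th u0 ->
  exists r, 0 < r /\ forall z z', box th u0 (peval p u0) r z -> box th u0 (peval p u0) r z' ->
    same_sign (cV th z - peval p (cU th z)) (cV th z' - peval p (cU th z')) ->
    forall fb, In fb Q -> same_sign (Phi (fst fb) (snd fb) z) (Phi (fst fb) (snd fb) z').
Proof.
  intros H. induction Q as [|[f be] Q IH].
  - exists 1. split; [lra|]. intros z z' _ _ _ fb [].
  - destruct IH as (r & Hr & HQ); [intros fb I; apply H; right; auto|].
    assert (E : exists r, 0 < r /\ forall z z', box th u0 (peval p u0) r z -> box th u0 (peval p u0) r z' ->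
      same_sign (cV th z - peval p (cU th z)) (cV th z' - peval p (cU th z')) ->
      same_sign (Phi f be z) (Phi f be z')).
    { destruct (H (f, be)) as [N|Z]; [left; auto| |]; simpl in *.
      - destruct (Phi_local_nonzero f p th be u0 N) as (r' & Hr' & G). exists r'. auto.
      - apply Phi_local_zero; auto. }
    destruct E as (r' & Hr' & G). exists (Rmin r r'). split; [apply Rmin_glb_lt; auto|].
    intros z z' Hz Hz' S fb [<-|I].
    + apply G; auto; eapply box_le; eauto; apply Rmin_r.
    + apply HQ; auto; eapply box_le; eauto; apply Rmin_l.
Qed.

Definition all_pairs (Bs : list basic_set) : list (rpoly * R) :=
  flat_map (fun b => fst b ++ snd b) Bs.

Lemma in_union_same_sign (Bs : list basic_set) (z z' : pt) :
  (forall fb, In fb (all_pairs Bs) -> same_sign (Phi (fst fb) (snd fb) z) (Phi (fst fb) (snd fb) z')) ->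
  in_union Bs z -> in_union Bs z'.
Proof.
  intros H (b & Ib & H0 & H1). exists b. split; auto.
  assert (I : forall fb, In fb (fst b ++ snd b) -> In fb (all_pairs Bs)).
  { intros fb I. apply in_flat_map. eauto. }
  split; intros fb J.
  - specialize (H0 fb J). destruct (H fb) as [S|[S|S]]; [apply I, in_or_app; auto|lra|lra|lra].
  - specialize (H1 fb J). destruct (H fb) as [S|[S|S]]; [apply I, in_or_app; auto|lra|lra|lra].
Qed.

Lemma locally_pos (h : pt -> R) (z : pt) :
  continuous h z -> 0 < h z -> locally z (fun w => 0 < h w).
Proof. intros H P. apply (H (fun y => 0 < y)). apply (open_gt 0); auto. Qed.

Lemma cU_continuous (th : R) (z : pt) : continuous (cU th) z.
Proof.
  apply (continuous_plus (fun z : pt => fst z * cos th) (fun z : pt => snd z * sin th)).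
  - apply (continuous_mult (fun z : pt => fst z) (fun _ => cos th)); [|apply continuous_const].
    destruct z; apply continuous_fst.
  - apply (continuous_mult (fun z : pt => snd z) (fun _ => sin th)); [|apply continuous_const].
    destruct z; apply continuous_snd.
Qed.

Lemma cV_continuous (th : R) (z : pt) : continuous (cV th) z.
Proof.
  apply (continuous_plus (fun z : pt => - fst z * sin th) (fun z : pt => snd z * cos th)).
  - apply (continuous_mult (fun z : pt => - fst z) (fun _ => sin th)); [|apply continuous_const].
    apply (continuous_opp (fun z : pt => fst z)). destruct z; apply continuous_fst.
  - apply (continuous_mult (fun z : pt => snd z) (fun _ => cos th)); [|apply continuous_const].
    destruct z; apply continuous_snd.
Qed.

Lemma Phi_continuous (f : rpoly) (th : R) (z : pt) : continuous (Phi f th) z.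
Proof.
  apply (continuous_minus (fun z => peval f (cU th z)) (cV th)); [|apply cV_continuous].
  apply (continuous_comp (cU th) (peval f)); [apply cU_continuous|].
  apply continuity_pt_filterlim, peval_continuity.
Qed.

Lemma locally_box (th u0 v0 r : R) (z : pt) : box th u0 v0 r z -> locally z (box th u0 v0 r).
Proof.
  intros [H1 H2].
  assert (G : forall (h : pt -> R) c, continuous h z -> Rabs (h z - c) < r ->
    locally z (fun w => Rabs (h w - c) < r)).
  { intros h c Hh Hc.
    eapply filter_imp; [|apply (locally_pos (fun w => r - Rabs (h w - c)))].
    - intros w Hw; simpl in Hw; lra.
    - apply (continuous_minus (fun _ => r) (fun w => Rabs (h w - c))); [apply continuous_const|].
      apply (continuous_comp (fun w => h w - c) Rabs); [|apply continuous_Rabs].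
      apply (continuous_minus h (fun _ => c)); auto. apply continuous_const.
    - lra. }
  apply filter_and; apply G; auto; [apply cU_continuous|apply cV_continuous].
Qed.

Lemma locally_normal_pts (th : R) (z : pt) (P : pt -> Prop) :
  locally z P -> exists e, 0 < e /\ P (rotinv th (cU th z) (cV th z + e)) /\
    P (rotinv th (cU th z) (cV th z - e)).
Proof.
  intros (eps & H).
  assert (G : forall e, Rabs e < eps -> P (rotinv th (cU th z) (cV th z + e))).
  { intros e He. apply H.
    assert (E : rotinv th (cU th z) (cV th z + e) = (fst z - e * sin th, snd z + e * cos th)).
    { rewrite <- (rotinv_cUV th z) at 3 4. unfold rotinv; simpl. f_equal; ring. }
    rewrite E. assert (forall c, Rabs c <= 1 -> Rabs (e * c) < eps).
    { intros c Hc. rewrite Rabs_mult. pose proof (Rabs_pos e).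
      apply Rle_lt_trans with (Rabs e * 1); [apply Rmult_le_compat_l; auto|lra]. }
    split; simpl.
    - unfold ball; simpl; unfold AbsRing_ball, abs, minus, plus, opp; simpl.
      replace (fst z - e * sin th + - fst z) with (- (e * sin th)) by ring.
      rewrite Rabs_Ropp. apply H0, Rabs_le, SIN_bound.
    - unfold ball; simpl; unfold AbsRing_ball, abs, minus, plus, opp; simpl.
      replace (snd z + e * cos th + - snd z) with (e * cos th) by ring.
      apply H0, Rabs_le, COS_bound. }
  pose proof (cond_pos eps). exists (eps / 2). split; [lra|]. split.
  - apply G. rewrite Rabs_right; lra.
  - apply G. rewrite Rabs_left; lra.
Qed.

Lemma convex_R_comb (K : R -> Prop) (a b l : R) :
  convex_R K -> K a -> K b -> 0 <= l <= 1 -> K ((1 - l) * a + l * b).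
Proof.
  intros HK Ha Hb Hl. destruct (Rle_dec a b).
  - apply (HK a b); auto. split; nra.
  - apply (HK b a); auto. split; nra.
Qed.

Lemma curve_cell_local (Bs : list basic_set) (p q1 q2 : rpoly) (th u0 : R) :
  let X := in_union Bs in
  (forall x, is_derive (peval p) x (peval q1 x)) ->
  (forall x, is_derive (peval q1) x (peval q2 x)) ->
  generic_param (all_pairs Bs) p th u0 ->
  (peval q2 u0 <> 0 \/ forall u, peval q2 u = 0) ->
  X (graph_pt p th u0) -> ~ locally (graph_pt p th u0) X ->
  exists d, 0 < d /\ forall K : R -> Prop, convex_R K -> (forall u, K u -> Rabs (u - u0) < d) ->
    (forall z, arc p th K z -> X z /\ ~ locally z X) /\
    forall A B g, shortest_curve X A B g -> exists N, interacts_at_most g (arc p th K) N.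
Proof.
  intros X D1 D2 Hgen Hcurv X0 NU0. set (v0 := peval p u0). set (z0 := graph_pt p th u0) in *.
  set (t := fun z => cV th z - peval p (cU th z)).
  assert (Hlin : exists r2, 0 < r2 /\ ((forall u, peval q2 u = 0) \/ exists sg, sg * sg = 1 /\
    forall u, Rabs (u - u0) < r2 -> 0 < sg * peval q2 u)).
  { destruct Hcurv as [N|Z]; [|exists 1; split; [lra|auto]].
    destruct (continuity_pt_near (peval q2) u0 (Rabs (peval q2 u0))) as (d & Hd & Hc);
      [apply peval_continuity|apply Rabs_pos_lt; auto|].
    exists d. split; auto. right. destruct (Rle_lt_dec 0 (peval q2 u0)).
    - exists 1. split; [ring|]. intros u Hu. specialize (Hc u Hu). apply Rabs_def2 in Hc.
      rewrite Rabs_right in Hc; lra.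
    - exists (-1). split; [ring|]. intros u Hu. specialize (Hc u Hu). apply Rabs_def2 in Hc.
      rewrite Rabs_left in Hc; lra. }
  destruct Hlin as (r2 & Hr2 & Hlin).
  destruct (signs_local (all_pairs Bs) p th u0 Hgen) as (r1 & Hr1 & Hs1). fold v0 in Hs1.
  set (r := Rmin r1 r2). assert (Hr : 0 < r) by (apply Rmin_glb_lt; auto).
  assert (HX : forall z z', box th u0 v0 r z -> box th u0 v0 r z' -> same_sign (t z) (t z') -> X z -> X z').
  { intros z z' Hz Hz' S. apply in_union_same_sign, Hs1; auto;
    eapply box_le; eauto; apply Rmin_l. }
  assert (B0 : box th u0 v0 r z0).
  { unfold z0, graph_pt, box. rewrite cU_rotinv, cV_rotinv. unfold v0.
    rewrite !Rminus_diag, Rabs_R0. auto. }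
  assert (t0 : t z0 = 0).
  { unfold t, z0, graph_pt. rewrite cU_rotinv, cV_rotinv. ring. }
  assert (HX0 : forall z, box th u0 v0 r z -> t z = 0 -> X z).
  { intros z Hz E. apply (HX z0); auto. right; left; auto. }
  assert (Dpos : (forall z, box th u0 v0 r z -> 0 < t z -> X z) \/
                 (forall z, box th u0 v0 r z -> 0 < t z -> ~ X z)).
  { destruct (classic (exists z, box th u0 v0 r z /\ 0 < t z /\ X z)) as [(z & Hz & P & Xz)|No].
    - left. intros z' Hz' P'. apply (HX z); auto. left; auto.
    - right. intros z Hz P Xz. eauto. }
  assert (Dneg : (forall z, box th u0 v0 r z -> t z < 0 -> X z) \/
                 (forall z, box th u0 v0 r z -> t z < 0 -> ~ X z)).
  { destruct (classic (exists z, box th u0 v0 r z /\ t z < 0 /\ X z)) as [(z & Hz & P & Xz)|No].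
    - left. intros z' Hz' P'. apply (HX z); auto. right; right; auto.
    - right. intros z Hz P Xz. eauto. }
  assert (ct : forall z, continuous (fun z => - t z) z).
  { intros z. apply (continuous_ext (Phi p th)); [|apply Phi_continuous].
    intros w. unfold t. rewrite Phi_cUV. simpl. ring. }
  assert (ct' : forall z, continuous t z).
  { intros z. apply (continuous_ext (fun z => - - t z)); [intros w; apply Ropp_involutive|].
    apply (continuous_opp (fun z => - t z)), ct. }
  assert (Opos : forall z, box th u0 v0 r z -> 0 < t z -> X z -> locally z X).
  { intros z Hz P Xz. eapply filter_imp;
      [|apply filter_and; [apply (locally_box _ _ _ _ _ Hz)|apply (locally_pos t z (ct' z) P)]].
    intros w [Hw Pw]. apply (HX z); auto. left; auto. }
  assert (Oneg : forall z, box th u0 v0 r z -> t z < 0 -> X z -> locally z X).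
  { intros z Hz P Xz. eapply filter_imp;
      [|apply filter_and; [apply (locally_box _ _ _ _ _ Hz)
        |apply (locally_pos (fun z => - t z) z (ct z)); simpl; lra]].
    intros w [Hw Pw]. apply (HX z); auto. right; right; split; [auto|lra]. }
  assert (HNU : forall z, box th u0 v0 r z -> t z = 0 -> ~ locally z X).
  { intros z Hz E L. apply NU0.
    destruct (locally_normal_pts th z _ (filter_and _ _ L (locally_box _ _ _ _ _ Hz)))
      as (e & He & [X1 B1] & [X2 B2]).
    assert (E1 : t (rotinv th (cU th z) (cV th z + e)) = e).
    { unfold t in *. rewrite cU_rotinv, cV_rotinv. lra. }
    assert (E2 : t (rotinv th (cU th z) (cV th z - e)) = - e).
    { unfold t in *. rewrite cU_rotinv, cV_rotinv. lra. }
    eapply filter_imp; [|apply (locally_box _ _ _ _ _ B0)].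
    intros w Hw. destruct (Rtotal_order (t w) 0) as [Nw|[Zw|Pw]]; [|auto|].
    - destruct Dneg as [D|D]; [auto|]. exfalso. apply (D _ B2); auto. lra.
    - destruct Dpos as [D|D]; [auto|]. exfalso. apply (D _ B1); auto. lra. }
  destruct (continuity_pt_near (peval p) u0 (r / 2)) as (d & Hd & Hc); [apply peval_continuity|lra|].
  fold v0 in Hc. exists (Rmin d (r / 2)). split; [apply Rmin_glb_lt; lra|].
  intros K HK HKd.
  assert (Hnear : forall u, K u -> Rabs (u - u0) < r / 2 /\ Rabs (peval p u - v0) < r / 2).
  { intros u Ku. specialize (HKd u Ku). pose proof (Rmin_l d (r / 2)). pose proof (Rmin_r d (r / 2)).
    split; [lra|apply Hc; lra]. }
  assert (Hbox : forall z, arc p th K z -> box th u0 v0 r z).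
  { intros z [E Kz]. destruct (Hnear _ Kz). rewrite <- E in H0. split; lra. }
  assert (Harc : forall z, arc p th K z -> X z /\ ~ locally z X).
  { intros z Hz. assert (t z = 0) by (destruct Hz as [E _]; unfold t; lra). auto. }
  split; auto. intros A B g Hg.
  destruct Hlin as [Z|(sg & Hsg & Hpos)].
  - exists 1%nat. apply (interacts_convex X _ A B); auto; [apply Harc|].
    assert (Aff : forall x, peval p x = peval p 0 + peval q1 0 * x).
    { apply affine_of_derive2; auto. intros x. rewrite <- (Z x). auto. }
    intros a b l [Ea Ka] [Eb Kb] Hl. split.
    + rewrite cU_seg, cV_seg, Ea, Eb, (Aff (cU th a)), (Aff (cU th b)), (Aff (_ + _)). ring.
    + rewrite cU_seg. apply convex_R_comb; auto.
  - apply (arc_interacts X p th u0 v0 r sg K A B g); auto.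
    + intros a b l Ha Hb. pose proof (Rmin_r r1 r2) as Hm. fold r in Hm.
      apply (strictly_convex_of_derive2 (fun u => sg * peval p u) (fun u => sg * peval q1 u)
        (fun u => sg * peval q2 u) u0 r2); auto; try lra.
      * intros x. apply (is_derive_scal (peval p)), D1.
      * intros x. apply (is_derive_scal (peval q1)), D2.
    + intros z Hz E. apply HX0; auto. apply Rmult_integral in E. destruct E; [nra|auto].
    + assert (C : sg = 1 \/ sg = -1).
      { assert (E : (sg - 1) * (sg + 1) = 0) by lra. apply Rmult_integral in E. lra. }
      destruct C as [-> | ->].
      * destruct Dpos as [D|D]; [left|right]; intros z Hz P; apply D; auto; unfold t; lra.
      * destruct Dneg as [D|D]; [left|right]; intros z Hz P; apply D; auto; unfold t; lra.
    + intros z Hz P Xz. destruct (Rtotal_order (t z) 0) as [L|[L|L]]; auto.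
      exfalso. fold (t z) in P. rewrite L in P. lra.
Qed.

(** * Cell decompositions *)

Definition decomposable (P : (pt -> Prop) -> Prop) (Y : pt -> Prop) : Prop :=
  exists (C : nat -> pt -> Prop) (used : nat -> Prop),
    (forall n, used n -> P (C n)) /\
    (forall n m z, used n -> used m -> C n z -> C m z -> n = m) /\
    (forall z, Y z <-> exists n, used n /\ C n z).

Lemma decomposable_ext (P : (pt -> Prop) -> Prop) (Y Y' : pt -> Prop) :
  (forall z, Y z <-> Y' z) -> decomposable P Y -> decomposable P Y'.
Proof.
  intros E (C & used & H1 & H2 & H3). exists C, used. repeat split; auto.
  - intros H. apply H3, E, H.
  - intros H. apply E, H3, H.
Qed.

Lemma decomposable_empty (P : (pt -> Prop) -> Prop) (Y : pt -> Prop) :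
  (forall z, ~ Y z) -> decomposable P Y.
Proof.
  intros H. exists (fun _ _ => False), (fun _ => False).
  split; [tauto|split; [tauto|]]. intros z; split.
  - intros Yz. destruct (H z Yz).
  - intros (_ & F & _). destruct F.
Qed.

Lemma decomposable_cell (P : (pt -> Prop) -> Prop) (Y : pt -> Prop) : P Y -> decomposable P Y.
Proof.
  intros H. exists (fun _ => Y), (fun n => n = 0%nat). repeat split; auto.
  - intros; congruence.
  - intros Yz. exists 0%nat. auto.
  - intros (_ & _ & Yz). auto.
Qed.

Lemma decomposable_union (P : (pt -> Prop) -> Prop) (Y1 Y2 : pt -> Prop) :
  (forall z, Y1 z -> Y2 z -> False) -> decomposable P Y1 -> decomposable P Y2 ->
  decomposable P (fun z => Y1 z \/ Y2 z).
Proof.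
  intros D (C1 & u1 & A1 & B1 & E1) (C2 & u2 & A2 & B2 & E2).
  exists (fun n => match Cantor.of_nat n with (O, k) => C1 k | (_, k) => C2 k end),
         (fun n => match Cantor.of_nat n with (O, k) => u1 k | (S O, k) => u2 k | _ => False end).
  repeat split.
  - intros n. destruct (Cantor.of_nat n) as [[|[|i]] k]; auto. tauto.
  - intros n m z.
    rewrite <- (Cantor.cancel_to_of n), <- (Cantor.cancel_to_of m), !Cantor.cancel_of_to.
    destruct (Cantor.of_nat n) as [[|[|i]] k], (Cantor.of_nat m) as [[|[|j]] l]; try tauto;
      intros U V Z W.
    + rewrite (B1 k l z); auto.
    + exfalso. apply (D z); [apply E1|apply E2]; eauto.
    + exfalso. apply (D z); [apply E1|apply E2]; eauto.
    + rewrite (B2 k l z); auto.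
  - intros [Y|Y].
    + apply E1 in Y. destruct Y as (k & U & Z). exists (Cantor.to_nat (O, k)).
      rewrite Cantor.cancel_of_to. auto.
    + apply E2 in Y. destruct Y as (k & U & Z). exists (Cantor.to_nat (S O, k)).
      rewrite Cantor.cancel_of_to. auto.
  - intros (n & U & Z). destruct (Cantor.of_nat n) as [[|[|i]] k]; [left|right|tauto].
    + apply E1; eauto.
    + apply E2; eauto.
Qed.

Lemma decomposable_finite (P : (pt -> Prop) -> Prop) (l : list pt) (Y : pt -> Prop) :
  (forall a, Y a -> P (fun z => z = a)) -> (forall z, Y z -> In z l) -> decomposable P Y.
Proof.
  revert Y. induction l as [|a l IH]; intros Y HP HY.
  - apply decomposable_empty. exact HY.
  - apply (decomposable_ext P (fun z => (Y z /\ z = a) \/ (Y z /\ z <> a))).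
    { intros z. destruct (classic (z = a)); tauto. }
    apply decomposable_union; [tauto| |].
    + destruct (classic (Y a)) as [Ya|Na].
      * apply (decomposable_ext P (fun z => z = a)); [|apply decomposable_cell; auto].
        intros z; split; [intros ->|]; tauto.
      * apply decomposable_empty. intros z [Yz ->]. auto.
    + apply IH; [intros b [Yb _]; auto|].
      intros z [Yz N]. destruct (HY z Yz); [congruence|auto].
Qed.

Lemma least_nat (Q : nat -> Prop) :
  (exists n, Q n) -> exists n, Q n /\ forall k, (k < n)%nat -> ~ Q k.
Proof.
  intros (n & Hn). revert Hn. induction n as [n IH] using (well_founded_induction Wf_nat.lt_wf).
  intros Hn. destruct (classic (exists k, (k < n)%nat /\ Q k)) as [(k & L & Hk)|No].
  - apply (IH k L Hk).
  - exists n. split; auto. intros k L Hk. eauto.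
Qed.

(* The cell of z is its class at the first level n at which that class is good. *)
Lemma decomposable_refinement (P : (pt -> Prop) -> Prop) (W Y : pt -> Prop) (code : nat -> pt -> nat) :
  (forall n z z', code (S n) z = code (S n) z' -> code n z = code n z') ->
  (forall z, Y z -> W z) ->
  (forall z, Y z -> exists n, P (fun z' => W z' /\ code n z' = code n z) /\
     forall z', W z' -> code n z' = code n z -> Y z') ->
  decomposable P Y.
Proof.
  intros Href HW HY.
  assert (Href' : forall n k z z', (k <= n)%nat -> code n z = code n z' -> code k z = code k z').
  { intros n k z z' L. induction L; auto. }
  set (Good := fun n c => P (fun z' => W z' /\ code n z' = c) /\
    forall z', W z' -> code n z' = c -> Y z').
  set (Rep := fun n c => exists z, W z /\ code n z = c /\ Good n c /\
    forall k, (k < n)%nat -> ~ Good k (code k z)).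
  exists (fun m z => W z /\ code (fst (Cantor.of_nat m)) z = snd (Cantor.of_nat m)),
         (fun m => Rep (fst (Cantor.of_nat m)) (snd (Cantor.of_nat m))).
  repeat split.
  - intros m (z & _ & _ & G & _). apply G.
  - intros m m' z H H' [_ Z] [_ Z'].
    rewrite <- (Cantor.cancel_to_of m), <- (Cantor.cancel_to_of m').
    destruct (Cantor.of_nat m) as [n c], (Cantor.of_nat m') as [n' c']. simpl in *.
    destruct H as (x & _ & Ex & Gx & Lx). destruct H' as (x' & _ & Ex' & Gx' & Lx').
    assert (En : n = n').
    { destruct (Nat.lt_trichotomy n n') as [L|[E|L]]; auto; exfalso.
      - apply (Lx' n L). rewrite <- (Href' n' n z x'); [rewrite Z; auto|lia|congruence].
      - apply (Lx n' L). rewrite <- (Href' n n' z x); [rewrite Z'; auto|lia|congruence]. }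
    subst n'. congruence.
  - intros Yz. destruct (least_nat (fun n => Good n (code n z))) as (n & Gn & Ln).
    { destruct (HY z Yz) as (n & G). exists n. exact G. }
    exists (Cantor.to_nat (n, code n z)). rewrite Cantor.cancel_of_to. simpl.
    split; [exists z|]; auto.
  - intros (m & (x & _ & _ & (_ & G) & _) & Wz & Ez). auto.
Qed.

Definition zcode (z : Z) : nat := Cantor.to_nat (Z.to_nat z, Z.to_nat (- z)).

Lemma zcode_inj (x y : Z) : zcode x = zcode y -> x = y.
Proof. unfold zcode. intros H. apply Cantor.to_nat_inj in H. inversion H. lia. Qed.

(* The two floors single out the dyadic points k / 2^n: a fiber of [dcode n] is such a point or
   an open interval between two consecutive ones. *)
Definition dcode (n : nat) (x : R) : nat :=
  Cantor.to_nat (zcode (Int_part (2 ^ n * x)), zcode (Int_part (- (2 ^ n * x)))).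

Lemma dcode_eq (n : nat) (x y : R) :
  dcode n x = dcode n y <->
  Int_part (2 ^ n * x) = Int_part (2 ^ n * y) /\ Int_part (- (2 ^ n * x)) = Int_part (- (2 ^ n * y)).
Proof.
  unfold dcode. split.
  - intros H. apply Cantor.to_nat_inj in H. inversion H. split; apply zcode_inj; auto.
  - intros [H1 H2]. rewrite H1, H2. auto.
Qed.

Lemma Int_part_ge (k : Z) (r : R) : IZR k <= r <-> (k <= Int_part r)%Z.
Proof.
  destruct (base_Int_part r) as [H1 H2]. split; intros H.
  - assert (k < Int_part r + 1)%Z; [|lia]. apply lt_IZR. rewrite plus_IZR. lra.
  - apply IZR_le in H. lra.
Qed.

Lemma Int_part_half (r s : R) : Int_part (2 * r) = Int_part (2 * s) -> Int_part r = Int_part s.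
Proof.
  assert (G : forall r s, Int_part (2 * r) = Int_part (2 * s) -> (Int_part r <= Int_part s)%Z).
  { intros x y E. apply Int_part_ge.
    assert (H : IZR (2 * Int_part x) <= 2 * y).
    { apply Int_part_ge. rewrite <- E. apply Int_part_ge. rewrite mult_IZR.
      destruct (base_Int_part x). lra. }
    rewrite mult_IZR in H. lra. }
  intros E. apply Z.le_antisymm; apply G; auto.
Qed.

Lemma dcode_refine (n : nat) (x y : R) : dcode (S n) x = dcode (S n) y -> dcode n x = dcode n y.
Proof.
  rewrite !dcode_eq. simpl pow. intros [H1 H2].
  split; apply Int_part_half.
  - rewrite <- !Rmult_assoc. auto.
  - replace (2 * - (2 ^ n * x)) with (- (2 * 2 ^ n * x)) by ring.
    replace (2 * - (2 ^ n * y)) with (- (2 * 2 ^ n * y)) by ring. auto.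
Qed.

Lemma dcode_near (n : nat) (x y : R) : dcode n y = dcode n x -> Rabs (y - x) < / 2 ^ n.
Proof.
  rewrite dcode_eq. intros [H _]. assert (0 < 2 ^ n) by (apply pow_lt; lra).
  apply Rmult_lt_reg_l with (2 ^ n); auto. rewrite Rinv_r by lra.
  rewrite <- (Rabs_right (2 ^ n)) at 1 by lra. rewrite <- Rabs_mult.
  destruct (base_Int_part (2 ^ n * x)), (base_Int_part (2 ^ n * y)). rewrite H in *.
  apply Rabs_def1; lra.
Qed.

Lemma dcode_cell (n : nat) (x : R) :
  (forall y, dcode n y = dcode n x <-> y = x) \/
  exists al be, al < be /\ forall y, dcode n y = dcode n x <-> al < y < be.
Proof.
  assert (P : 0 < 2 ^ n) by (apply pow_lt; lra).
  destruct (base_Int_part (2 ^ n * x)) as [I1 I2].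
  set (k := Int_part (2 ^ n * x)) in *.
  destruct (Req_dec (IZR k) (2 ^ n * x)) as [E|N].
  - left. intros y. split; [|intros ->; auto]. rewrite dcode_eq. intros [H1 H2].
    apply Rmult_eq_reg_l with (2 ^ n); [|lra]. rewrite <- E. apply Rle_antisym.
    + assert (H : IZR (- k) <= - (2 ^ n * y)).
      { apply Int_part_ge. rewrite H2. apply Int_part_ge. rewrite opp_IZR. lra. }
      rewrite opp_IZR in H. lra.
    + apply Int_part_ge. rewrite H1. fold k. lia.
  - right. exists (IZR k / 2 ^ n), ((IZR k + 1) / 2 ^ n).
    assert (S : forall y, IZR k / 2 ^ n < y < (IZR k + 1) / 2 ^ n <->
      IZR k < 2 ^ n * y < IZR k + 1).
    { intros y. split; intros [H1 H2]; split.
      - apply Rmult_lt_compat_l with (r := 2 ^ n) in H1; auto.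
        replace (2 ^ n * (IZR k / 2 ^ n)) with (IZR k) in H1 by (field; lra). auto.
      - apply Rmult_lt_compat_l with (r := 2 ^ n) in H2; auto.
        replace (2 ^ n * ((IZR k + 1) / 2 ^ n)) with (IZR k + 1) in H2 by (field; lra). auto.
      - apply Rmult_lt_reg_l with (2 ^ n); auto.
        replace (2 ^ n * (IZR k / 2 ^ n)) with (IZR k) by (field; lra). auto.
      - apply Rmult_lt_reg_l with (2 ^ n); auto.
        replace (2 ^ n * ((IZR k + 1) / 2 ^ n)) with (IZR k + 1) by (field; lra). auto. }
    split; [apply Rmult_lt_compat_r; [apply Rinv_0_lt_compat; auto|lra]|].
    assert (F : forall y, IZR k < 2 ^ n * y < IZR k + 1 ->
      Int_part (2 ^ n * y) = k /\ Int_part (- (2 ^ n * y)) = (- k - 1)%Z).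
    { intros y Hy. split; symmetry; apply Int_part_spec.
      - lra.
      - rewrite minus_IZR, opp_IZR. lra. }
    assert (Fx : IZR k < 2 ^ n * x < IZR k + 1) by lra.
    intros y. rewrite S, dcode_eq. destruct (F x Fx) as [Ex1 Ex2]. split.
    + rewrite Ex2. fold k. intros [H1 H2].
      destruct (base_Int_part (2 ^ n * y)) as [J1 J2]. rewrite H1 in J1, J2.
      destruct (base_Int_part (- (2 ^ n * y))) as [J3 J4]. rewrite H2 in J3, J4.
      rewrite minus_IZR, opp_IZR in J3, J4. lra.
    + intros Hy. destruct (F y Hy) as [-> ->]. rewrite Ex2. auto.
Qed.

Lemma dcode_convex (n : nat) (c : nat) : convex_R (fun x => dcode n x = c).
Proof.
  intros x y z Hx Hy Hz. rewrite <- Hx in *.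
  destruct (dcode_cell n x) as [H|(al & be & _ & H)].
  - apply H in Hy. apply H. lra.
  - pose proof (proj1 (H x) eq_refl). apply H in Hy. apply H. lra.
Qed.

Lemma dcode_small (d : R) : 0 < d -> exists n, forall x y, dcode n y = dcode n x -> Rabs (y - x) < d.
Proof.
  intros Hd. destruct (pow_lt_1_zero (/ 2)) with (y := d) as (n & Hn); auto.
  { rewrite Rabs_right; lra. }
  exists n. intros x y H. apply dcode_near in H. specialize (Hn n (Nat.le_refl n)).
  rewrite pow_inv in Hn. eapply Rlt_trans; [exact H|].
  eapply Rle_lt_trans; [apply Rle_abs|exact Hn].
Qed.

Lemma interval_chart (al be : R) : al < be ->
  exists psi : R -> R, (forall s s', s < s' -> psi s < psi s') /\ (forall s, al < psi s < be) /\
    (forall y, al < y < be -> exists s, y = psi s) /\ (forall s, continuity_pt psi s).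
Proof.
  intros H. pose proof PI_RGT_0 as HPI.
  exists (fun s => al + (be - al) * (atan s / PI + / 2)). split; [|split; [|split]].
  - intros s s' L. apply atan_increasing in L.
    apply Rplus_lt_compat_l, Rmult_lt_compat_l; [lra|]. apply Rplus_lt_compat_r.
    apply Rmult_lt_compat_r; auto. apply Rinv_0_lt_compat; auto.
  - intros s. destruct (atan_bound s) as [B1 B2].
    assert (K : - / 2 < atan s / PI < / 2).
    { split; apply Rmult_lt_reg_r with PI; auto;
      replace (atan s / PI * PI) with (atan s) by (field; lra); lra. }
    split; nra.
  - intros y Hy. exists (tan (PI * ((y - al) / (be - al) - / 2))).
    assert (K : 0 < (y - al) / (be - al) < 1).
    { split; apply Rmult_lt_reg_r with (be - al); try lra;
      replace ((y - al) / (be - al) * (be - al)) with (y - al) by (field; lra); lra. }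
    rewrite atan_tan by (split; nra). field. lra.
  - intros s. apply continuity_pt_plus; [apply continuity_pt_cst|].
    apply continuity_pt_mult; [apply continuity_pt_cst|].
    apply continuity_pt_plus; [|apply continuity_pt_cst].
    apply continuity_pt_mult; [|apply continuity_pt_cst].
    apply derivable_continuous_pt, derivable_pt_atan.
Qed.

Lemma increasing_inverse_continuous (psi : R -> R) (s eps : R) :
  (forall s s', s < s' -> psi s < psi s') -> 0 < eps ->
  exists d, 0 < d /\ forall s', Rabs (psi s' - psi s) < d -> Rabs (s' - s) < eps.
Proof.
  intros Hi He. exists (Rmin (psi (s + eps) - psi s) (psi s - psi (s - eps))). split.
  - pose proof (Hi s (s + eps)). pose proof (Hi (s - eps) s). apply Rmin_glb_lt; lra.
  - intros s' H. apply Rabs_def2 in H.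
    pose proof (Rmin_l (psi (s + eps) - psi s) (psi s - psi (s - eps))).
    pose proof (Rmin_r (psi (s + eps) - psi s) (psi s - psi (s - eps))).
    apply Rabs_def1; apply Rnot_le_lt; intros L.
    + assert (psi (s + eps) <= psi s'); [|lra].
      destruct (Req_dec (s + eps) s') as [->|]; [lra|]. left; apply Hi; lra.
    + assert (psi s' <= psi (s - eps)); [|lra].
      destruct (Req_dec s' (s - eps)) as [->|]; [lra|]. left; apply Hi; lra.
Qed.

Lemma increasing_inj (psi : R -> R) (s s' : R) :
  (forall s s', s < s' -> psi s < psi s') -> psi s = psi s' -> s = s'.
Proof.
  intros Hi E. destruct (Rtotal_order s s') as [L|[L|L]]; auto; apply Hi in L; lra.
Qed.

Lemma dist2_bounds (z w : pt) :
  Rabs (fst z - fst w) <= dist2 z w /\ Rabs (snd z - snd w) <= dist2 z w /\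
  dist2 z w <= Rabs (fst z - fst w) + Rabs (snd z - snd w).
Proof.
  destruct (sqrt_plus_sqr (fst z - fst w) (snd z - snd w)) as [H _].
  fold (dist2 z w) in H. split; [|split].
  - eapply Rle_trans; [apply Rmax_l|exact H].
  - eapply Rle_trans; [apply Rmax_r|exact H].
  - pose proof (Rabs_pos (fst z - fst w)). pose proof (Rabs_pos (snd z - snd w)).
    apply Rsqr_incr_0_var; [|lra]. unfold Rsqr. rewrite dist2_sqr, <- !(pow2_abs (_ - _)). nra.
Qed.

Lemma arc_homeo (e : R -> pt) (al be : R) (Z : pt -> Prop) : al < be ->
  (forall u, continuity_pt (fun u => fst (e u)) u) ->
  (forall u, continuity_pt (fun u => snd (e u)) u) ->
  (forall u u', Rabs (u - u') <= dist2 (e u) (e u')) ->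
  (forall z, Z z <-> exists u, al < u < be /\ z = e u) ->
  homeo_Rd Z 1.
Proof.
  intros Hab c1 c2 Hl HZ. destruct (interval_chart al be Hab) as (psi & Hi & Hb & Hs & Hc).
  exists (fun s => e (psi s)). split; [|split; [|split]].
  - intros z. rewrite HZ. split.
    + intros (u & Hu & ->). destruct (Hs u Hu) as (s & ->). eauto.
    + intros (s & ->). eauto.
  - intros s s' E. apply (increasing_inj psi); auto. apply Rminus_diag_uniq.
    specialize (Hl (psi s) (psi s')). rewrite E in Hl.
    unfold dist2 in Hl. rewrite !Rminus_diag in Hl.
    replace (0 ^ 2 + 0 ^ 2) with 0 in Hl by ring. rewrite sqrt_0 in Hl.
    destruct (Req_dec (psi s - psi s') 0) as [|N]; auto. apply Rabs_pos_lt in N. lra.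
  - intros s eps He.
    destruct (continuity_pt_near (fun s => fst (e (psi s))) s (eps / 2)) as (d1 & P1 & Q1); [|lra|].
    { apply (continuity_pt_comp psi (fun u => fst (e u))); auto. }
    destruct (continuity_pt_near (fun s => snd (e (psi s))) s (eps / 2)) as (d2 & P2 & Q2); [|lra|].
    { apply (continuity_pt_comp psi (fun u => snd (e u))); auto. }
    exists (Rmin d1 d2). split; [apply Rmin_glb_lt; auto|]. intros s' H.
    pose proof (Rmin_l d1 d2). pose proof (Rmin_r d1 d2).
    destruct (dist2_bounds (e (psi s')) (e (psi s))) as (_ & _ & D).
    specialize (Q1 s'). specialize (Q2 s'). simpl in Q1, Q2. lra.
  - intros s eps He. destruct (increasing_inverse_continuous psi s eps Hi He) as (d & Hd & H).
    exists d. split; auto. intros s' Hs'. apply H. eapply Rle_lt_trans; [apply Hl|exact Hs'].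
Qed.

Lemma rectangle_homeo (a1 b1 a2 b2 : R) (Z : pt -> Prop) : a1 < b1 -> a2 < b2 ->
  (forall z, Z z <-> a1 < fst z < b1 /\ a2 < snd z < b2) -> homeo_Rd Z 2.
Proof.
  intros H1 H2 HZ.
  destruct (interval_chart a1 b1 H1) as (psi1 & Hi1 & Hb1 & Hs1 & Hc1).
  destruct (interval_chart a2 b2 H2) as (psi2 & Hi2 & Hb2 & Hs2 & Hc2).
  exists (fun s => (psi1 (fst s), psi2 (snd s))). split; [|split; [|split]].
  - intros [x y]. rewrite HZ. simpl. split.
    + intros [Hx Hy]. destruct (Hs1 x Hx) as (s1 & ->). destruct (Hs2 y Hy) as (s2 & ->).
      exists (s1, s2). auto.
    + intros (s & E). inversion E. auto.
  - intros [s1 s2] [s1' s2'] E. simpl in E. inversion E.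
    f_equal; [apply (increasing_inj psi1)|apply (increasing_inj psi2)]; auto.
  - intros s eps He.
    destruct (continuity_pt_near psi1 (fst s) (eps / 2)) as (d1 & P1 & Q1); [auto|lra|].
    destruct (continuity_pt_near psi2 (snd s) (eps / 2)) as (d2 & P2 & Q2); [auto|lra|].
    exists (Rmin d1 d2). split; [apply Rmin_glb_lt; auto|]. intros s' H.
    pose proof (Rmin_l d1 d2). pose proof (Rmin_r d1 d2).
    destruct (dist2_bounds s' s) as (D1 & D2 & _).
    destruct (dist2_bounds (psi1 (fst s'), psi2 (snd s')) (psi1 (fst s), psi2 (snd s))) as (_ & _ & D).
    simpl in D. specialize (Q1 (fst s')). specialize (Q2 (snd s')). lra.
  - intros s eps He.
    destruct (increasing_inverse_continuous psi1 (fst s) (eps / 2) Hi1) as (d1 & P1 & Q1); [lra|].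
    destruct (increasing_inverse_continuous psi2 (snd s) (eps / 2) Hi2) as (d2 & P2 & Q2); [lra|].
    exists (Rmin d1 d2). split; [apply Rmin_glb_lt; auto|]. intros s' H.
    pose proof (Rmin_l d1 d2). pose proof (Rmin_r d1 d2).
    destruct (dist2_bounds s' s) as (_ & _ & D).
    destruct (dist2_bounds (psi1 (fst s'), psi2 (snd s')) (psi1 (fst s), psi2 (snd s))) as (D1 & D2 & _).
    simpl in D1, D2. specialize (Q1 (fst s')). specialize (Q2 (snd s')). lra.
Qed.

Definition good_cell (X : pt -> Prop) (S : pt -> Prop) : Prop :=
  (exists d, (d <= 2)%nat /\ homeo_Rd S d) /\
  forall A B g, shortest_curve X A B g -> exists N, interacts_at_most g S N.

Lemma good_cell_point (X : pt -> Prop) (a : pt) : X a -> good_cell X (fun z => z = a).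
Proof.
  intros Xa. split.
  - exists 0%nat. split; [lia|]. exists a. tauto.
  - intros A B g Hg. exists 1%nat. apply (interacts_convex X _ A B g Hg).
    + intros z ->. auto.
    + intros b c l -> -> _. apply seg_same.
Qed.

Lemma dyadic_cell_homeo (n : nat) (z : pt) (S : pt -> Prop) :
  (forall w, S w <-> dcode n (fst w) = dcode n (fst z) /\ dcode n (snd w) = dcode n (snd z)) ->
  exists d, (d <= 2)%nat /\ homeo_Rd S d.
Proof.
  intros HS.
  assert (cid : forall u, continuity_pt (fun u => u) u).
  { intros u. apply derivable_continuous_pt, derivable_pt_id. }
  destruct (dcode_cell n (fst z)) as [E1|(a1 & b1 & L1 & E1)];
  destruct (dcode_cell n (snd z)) as [E2|(a2 & b2 & L2 & E2)].
  - exists 0%nat. split; [lia|]. exists z. intros w. rewrite HS, E1, E2. split.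
    + intros [H1 H2]. rewrite (surjective_pairing w), (surjective_pairing z), H1, H2. auto.
    + intros ->. auto.
  - exists 1%nat. split; [lia|]. apply (arc_homeo (fun u => (fst z, u)) a2 b2); auto.
    + intros u. apply (continuity_pt_cst (fst z)).
    + intros u u'. apply (dist2_bounds (fst z, u) (fst z, u')).
    + intros w. rewrite HS, E1, E2. split.
      * intros [H1 H2]. exists (snd w). rewrite <- H1. split; auto. apply surjective_pairing.
      * intros (u & Hu & ->). auto.
  - exists 1%nat. split; [lia|]. apply (arc_homeo (fun u => (u, snd z)) a1 b1); auto.
    + intros u. apply (continuity_pt_cst (snd z)).
    + intros u u'. apply (dist2_bounds (u, snd z) (u', snd z)).
    + intros w. rewrite HS, E1, E2. split.
      * intros [H1 H2]. exists (fst w). rewrite <- H2. split; auto. apply surjective_pairing.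
      * intros (u & Hu & ->). auto.
  - exists 2%nat. split; [lia|]. apply (rectangle_homeo a1 b1 a2 b2); auto.
    intros w. rewrite HS, E1, E2. tauto.
Qed.

Lemma interior_decomposable (X : pt -> Prop) : decomposable (good_cell X) (fun z => locally z X).
Proof.
  set (code := fun n (z : pt) => Cantor.to_nat (dcode n (fst z), dcode n (snd z))).
  assert (Hcode : forall n z z', code n z = code n z' <->
    dcode n (fst z) = dcode n (fst z') /\ dcode n (snd z) = dcode n (snd z')).
  { intros n z z'. unfold code. split.
    - intros H. apply Cantor.to_nat_inj in H. inversion H. auto.
    - intros [-> ->]. auto. }
  apply (decomposable_refinement _ (fun _ => True) _ code); auto.
  - intros n z z'. rewrite !Hcode. intros [H1 H2]. split; apply dcode_refine; auto.
  - intros z Hz. apply locally_locally in Hz. destruct Hz as (eps & Heps).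
    destruct (dcode_small eps (cond_pos eps)) as (n & Hn). exists n.
    assert (HU : forall w, code n w = code n z -> locally w X).
    { intros w Hw. apply Hcode in Hw. apply Heps. split; apply Hn; apply Hw. }
    split; [split|].
    + apply (dyadic_cell_homeo n z). intros w. rewrite Hcode. tauto.
    + intros A B g Hg. exists 1%nat. apply (interacts_convex X _ A B g Hg).
      * intros w [_ Hw]. apply (locally_singleton w X), HU, Hw.
      * intros a b l [_ Ha] [_ Hb] Hl. split; auto. apply Hcode in Ha, Hb. apply Hcode.
        split; [apply (convex_R_comb (fun x => dcode n x = dcode n (fst z)))
               |apply (convex_R_comb (fun x => dcode n x = dcode n (snd z)))];
          try apply dcode_convex; try apply Ha; try apply Hb; auto.
    + intros w _ Hw. auto.
Qed.

Lemma graph_pt_continuity (p : rpoly) (th u : R) :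
  continuity_pt (fun u => fst (graph_pt p th u)) u /\ continuity_pt (fun u => snd (graph_pt p th u)) u.
Proof.
  assert (cid : continuity_pt (fun u => u) u) by apply derivable_continuous_pt, derivable_pt_id.
  split.
  - apply continuity_pt_minus; apply continuity_pt_mult; auto using continuity_pt_cst.
    apply peval_continuity.
  - apply continuity_pt_plus; apply continuity_pt_mult; auto using continuity_pt_cst.
    apply peval_continuity.
Qed.

Lemma graph_pt_dist (p : rpoly) (th u u' : R) :
  Rabs (u - u') <= dist2 (graph_pt p th u) (graph_pt p th u').
Proof.
  assert (G : forall z w, cU th z - cU th w <= dist2 z w).
  { intros z w. pose proof (cauchy_schwarz_plane (fst z - fst w) (snd z - snd w) (cos th) (sin th)) as H.
    replace (cos th ^ 2 + sin th ^ 2) with 1 in H by (rewrite <- (cos_sin_sqr th); ring).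
    rewrite sqrt_1, Rmult_1_r in H. unfold cU, dist2. lra. }
  pose proof (G (graph_pt p th u) (graph_pt p th u')) as G1.
  pose proof (G (graph_pt p th u') (graph_pt p th u)) as G2.
  rewrite (dist2_sym (graph_pt p th u')) in G2. unfold graph_pt in *. rewrite !cU_rotinv in G1, G2.
  apply Rabs_le. lra.
Qed.

Lemma on_graph (p : rpoly) (th : R) (z : pt) :
  cV th z = peval p (cU th z) -> z = graph_pt p th (cU th z).
Proof. intros E. unfold graph_pt. rewrite <- E. symmetry; apply rotinv_cUV. Qed.

Lemma arc_homeo_Rd (p : rpoly) (th : R) (n : nat) (u0 : R) :
  exists d, (d <= 2)%nat /\ homeo_Rd (arc p th (fun u => dcode n u = dcode n u0)) d.
Proof.
  destruct (dcode_cell n u0) as [E|(al & be & L & E)].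
  - exists 0%nat. split; [lia|]. exists (graph_pt p th u0). intros z. split.
    + intros [Ez Hz]. apply E in Hz. rewrite <- Hz. apply on_graph; auto.
    + intros ->. unfold arc, graph_pt. rewrite cU_rotinv, cV_rotinv. auto.
  - exists 1%nat. split; [lia|]. apply (arc_homeo (graph_pt p th) al be); auto.
    + intros u. apply (graph_pt_continuity p th u).
    + intros u. apply (graph_pt_continuity p th u).
    + apply graph_pt_dist.
    + intros z. split.
      * intros [Ez Hz]. apply E in Hz. exists (cU th z). split; auto. apply on_graph; auto.
      * intros (u & Hu & ->). unfold arc, graph_pt. rewrite cU_rotinv, cV_rotinv. split; auto.
        apply E; auto.
Qed.

Lemma locally_not_in (l : list pt) (z : pt) : ~ In z l -> locally z (fun w => ~ In w l).
Proof.
  induction l as [|a l IH]; intros H.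
  - apply filter_forall. intros w [].
  - simpl in H. apply (filter_imp (fun w => a <> w /\ ~ In w l)).
    { intros w [H1 H2] [E|I]; auto. }
    apply filter_and; [|apply IH; tauto].
    assert (N : fst z <> fst a \/ snd z <> snd a).
    { apply NNPP. intros N. apply H. left.
      rewrite (surjective_pairing a), (surjective_pairing z).
      f_equal; apply NNPP; intros N'; apply N; [left|right]; auto. }
    destruct N as [N|N].
    + apply (filter_imp (fun w : pt => fst w <> fst a)); [congruence|].
      destruct z as [z1 z2].
      apply (@continuous_fst R_UniformSpace R_UniformSpace z1 z2 (fun x => x <> fst a)).
      apply (open_neq (fst a)); auto.
    + apply (filter_imp (fun w : pt => snd w <> snd a)); [congruence|].
      destruct z as [z1 z2].
      apply (@continuous_snd R_UniformSpace R_UniformSpace z1 z2 (fun x => x <> snd a)).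
      apply (open_neq (snd a)); auto.
Qed.

Lemma graph_pt_locally (p : rpoly) (th u0 : R) (O : pt -> Prop) :
  locally (graph_pt p th u0) O ->
  exists d, 0 < d /\ forall u, Rabs (u - u0) < d -> O (graph_pt p th u).
Proof.
  intros (eps & H). destruct (graph_pt_continuity p th u0) as [c1 c2].
  destruct (continuity_pt_near _ u0 eps c1 (cond_pos eps)) as (d1 & P1 & Q1).
  destruct (continuity_pt_near _ u0 eps c2 (cond_pos eps)) as (d2 & P2 & Q2).
  exists (Rmin d1 d2). split; [apply Rmin_glb_lt; auto|]. intros u Hu.
  apply H. split; [apply Q1|apply Q2]; (eapply Rlt_le_trans; [exact Hu|]); [apply Rmin_l|apply Rmin_r].
Qed.

Lemma curves_decomposable (Bs : list basic_set) (Gs : list (rpoly * R)) (O : pt -> Prop) :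
  let X := in_union Bs in
  (forall z, O z -> locally z O) ->
  (forall z, X z -> ~ locally z X -> O z -> exists gt, In gt Gs /\ Phi (fst gt) (snd gt) z = 0) ->
  decomposable (good_cell X) (fun z => (X z /\ ~ locally z X) /\ O z).
Proof.
  intros X. revert O. induction Gs as [|[p th] Gs IH]; intros O HO Hcov.
  - apply decomposable_empty. intros z [[H1 H2] H3]. destruct (Hcov z H1 H2 H3) as (gt & [] & _).
  - destruct (rpoly_derive p) as (q1 & D1). destruct (rpoly_derive q1) as (q2 & D2).
    destruct (generic_param_cofinite (all_pairs Bs) p th) as (L & HL).
    destruct (rpoly_roots q2) as (M & HM).
    set (PL := map (graph_pt p th) (L ++ M)).
    set (O1 := fun z => O z /\ ~ In z PL).
    assert (HO1 : forall z, O1 z -> locally z O1).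
    { intros z [H1 H2]. apply filter_and; [auto|apply locally_not_in; auto]. }
    set (O2 := fun z => O1 z /\ Phi p th z <> 0).
    assert (HO2 : forall z, O2 z -> locally z O2).
    { intros z [H1 H2]. apply filter_and; [auto|].
      apply (Phi_continuous p th z (fun y => y <> 0)). apply (open_neq 0); auto. }
    set (W := fun z => cV th z = peval p (cU th z)).
    assert (HW : forall z, W z <-> Phi p th z = 0).
    { intros z. unfold W. rewrite Phi_cUV. split; lra. }
    apply (decomposable_ext _ (fun z => (((X z /\ ~ locally z X) /\ O z) /\ In z PL) \/
      ((((X z /\ ~ locally z X) /\ O1 z) /\ W z) \/ ((X z /\ ~ locally z X) /\ O2 z)))).
    { intros z. unfold O2, O1. rewrite HW. destruct (classic (In z PL)), (classic (Phi p th z = 0)); tauto. }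
    apply decomposable_union; [unfold O2, O1; tauto| |apply decomposable_union].
    + apply (decomposable_finite _ PL); [|tauto]. intros a Ha. apply good_cell_point; tauto.
    + intros z. unfold O2. rewrite HW. tauto.
    + apply (decomposable_refinement _ W _ (fun n z => dcode n (cU th z))); [|tauto|].
      { intros; apply dcode_refine; auto. }
      intros z [[[Xz Uz] Oz] Wz]. set (u0 := cU th z).
      assert (Ez : z = graph_pt p th u0) by (apply on_graph; auto).
      assert (Nu : ~ In u0 (L ++ M)).
      { intros I. apply (proj2 Oz). rewrite Ez. apply in_map; auto. }
      destruct (curve_cell_local Bs p q1 q2 th u0 D1 D2) as (d & Hd & Hloc).
      * apply HL. intros I; apply Nu, in_or_app; auto.
      * destruct (Req_dec (peval q2 u0) 0) as [Z|NZ]; [right|left; auto].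
        destruct (HM u0 Z); auto. exfalso; apply Nu, in_or_app; auto.
      * rewrite <- Ez. auto.
      * rewrite <- Ez. auto.
      * destruct (graph_pt_locally p th u0 O1) as (d' & Hd' & HO').
        { rewrite <- Ez. auto. }
        destruct (dcode_small (Rmin d d')) as (n & Hn); [apply Rmin_glb_lt; auto|].
        exists n.
        destruct (Hloc (fun u => dcode n u = dcode n u0)) as [HE HI].
        { apply dcode_convex. }
        { intros u Hu. eapply Rlt_le_trans; [apply Hn, Hu|apply Rmin_l]. }
        split; [split; [apply (arc_homeo_Rd p th n u0)|exact HI]|].
        intros w Ww Hw. split; auto. split; [apply HE; split; auto|].
        rewrite (on_graph p th w Ww). apply HO'.
        eapply Rlt_le_trans; [apply Hn, Hw|apply Rmin_r].
    + apply IH; auto. intros z Xz Uz [[Oz _] Nz].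
      destruct (Hcov z Xz Uz Oz) as (gt & [<-|I] & E); [contradiction|eauto].
Qed.

Lemma in_basic_no_equation_locally (b : basic_set) (z : pt) :
  fst b = nil -> in_basic b z -> locally z (in_basic b).
Proof.
  destruct b as [gs fs]. simpl. intros -> [_ H]. simpl in H.
  apply (filter_imp (fun w => forall fb, In fb fs -> Phi (fst fb) (snd fb) w > 0)).
  { intros w Hw. split; auto. intros gt []. }
  induction fs as [|fb fs IH].
  - apply filter_forall. intros w fb [].
  - apply (filter_imp (fun w => Phi (fst fb) (snd fb) w > 0 /\
      forall fb', In fb' fs -> Phi (fst fb') (snd fb') w > 0)).
    { intros w [H1 H2] fb' [<-|I]; auto. }
    apply filter_and; [|apply IH; intros; apply H; right; auto].
    apply (locally_pos (Phi (fst fb) (snd fb))); [apply Phi_continuous|apply H; left; auto].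
Qed.

Theorem theorem4p10 (Bs : list basic_set) :
  exists (C : nat -> pt -> Prop) (used : nat -> Prop),
    cell_decomposition (in_union Bs) C used /\
    forall (A B : pt) (gamma : R -> pt),
      shortest_curve (in_union Bs) A B gamma ->
      forall n, used n -> exists N : nat, interacts_at_most gamma (C n) N.
Proof.
  set (X := in_union Bs).
  assert (D : decomposable (good_cell X) X).
  { apply (decomposable_ext _ (fun z => locally z X \/ ((X z /\ ~ locally z X) /\ True))).
    { intros z. pose proof (locally_singleton z X). destruct (classic (locally z X)); tauto. }
    apply decomposable_union; [tauto|apply interior_decomposable|].
    apply (curves_decomposable Bs (flat_map fst Bs) (fun _ => True)).
    - intros z _. apply filter_forall; auto.
    - intros z (b & Ib & Hb) Uz _. destruct (fst b) as [|gt gs] eqn:E.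
      + exfalso. apply Uz. apply (filter_imp (in_basic b)); [intros w Hw; exists b; auto|].
        apply in_basic_no_equation_locally; auto.
      + exists gt. split; [|apply Hb; rewrite E; left; auto].
        apply in_flat_map. exists b. rewrite E. split; auto. left; auto. }
  destruct D as (C & used & H1 & H2 & H3). exists C, used.
  split; [split; [|split]; auto|].
  - intros n Hn. apply (H1 n Hn).
  - intros A B g Hg n Hn. apply (proj2 (H1 n Hn) A B g Hg).
Qed.
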